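(* Let $S$ be the network generated by $(V,E,\lambda)$. Define \[ \bar n \;=\; 3\,\operatorname{card}(E)+\sum_{e\in E}\left\lceil \frac{5\lambda(e)}{\min_{e'\in E}\lambda(e')}\right\rceil . \] Then for every integer $n\ge \bar n$, the location game $\mathcal L(n,S)$ admits a pure Nash equilibrium.
   Context: Network: $(V,E)$ is a finite connected graph with at least one edge and no vertex of degree $2$; each edge $e$ has a length $\lambda(e)>0$. The network $S$ is the metric measure space obtained by identifying each edge $e=(u,v)$ with a segment of length $\lambda(e)$ joining $u$ and $v$ (glued at common vertices). The measure $\lambda$ on $S$ is one-dimensional length measure, and $d(x,y)$ is the length of a shortest path in $S$ between $x$ and $y$. A vertex of degree $1$ is a leaf. Location game $\mathcal L(n,S)$: there are $n$ players (retailers), $N=\{1,\dots,n\}$. Each player chooses a point $x_i\in S$. Consumers are distributed on $S$ according to $\lambda$, and each consumer shops at a closest occupied location. Ties are resolved as follows. For a set $K$ of occupied locations, let $Y_K$ be the set of points of $S$ equidistant from all locations in $K$ and strictly closer to them than to any other occupied location. The mass $\lambda(Y_K)$ is split equally among the locations in $K$, and the share of each location is split equally among the players located there. The payoff $\rho_i(\boldsymbol x)$ of player $i$ is the total mass of consumers she attracts. A (pure) Nash equilibrium is a profile from which no player can increase her payoff by a unilateral change of location. *)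

(* Defs.v *)
From Stdlib Require Import Bool Reals Lra Lia ZArith Arith List Classical ClassicalEpsilon.
Open Scope R_scope.

(* A network (V,E,lambda): vertices are 0..nV-1, edges are 0..nE-1,
   edge e joins src e and dst e and has length len e. *)
Record network := mkNetwork {
  nV : nat;
  nE : nat;
  src : nat -> nat;
  dst : nat -> nat;
  len : nat -> R
}.

Fixpoint walk (N : network) (a b : nat) (w : list nat) : Prop :=
  match w with
  | nil => a = b
  | e :: w' => (e < nE N)%nat /\
      ((src N e = a /\ walk N (dst N e) b w') \/
       (dst N e = a /\ walk N (src N e) b w'))
  end.

Definition wlen (N : network) (w : list nat) : R :=
  fold_right Rplus 0 (map (len N) w).

Definition degree (N : network) (v : nat) : nat :=
  length (filter (fun e => orb (Nat.eqb (src N e) v) (Nat.eqb (dst N e) v)) (seq 0 (nE N))).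

Definition is_network (N : network) : Prop :=
  (1 <= nE N)%nat /\
  (forall e, (e < nE N)%nat ->
     (src N e < nV N)%nat /\ (dst N e < nV N)%nat /\ src N e <> dst N e /\ 0 < len N e) /\
  (forall e e', (e < nE N)%nat -> (e' < nE N)%nat -> e <> e' ->
     ~ ((src N e = src N e' /\ dst N e = dst N e') \/
        (src N e = dst N e' /\ dst N e = src N e'))) /\
  (forall u v, (u < nV N)%nat -> (v < nV N)%nat -> exists w, walk N u v w) /\
  (forall v, (v < nV N)%nat -> degree N v <> 2%nat).

(* A point of S: (e, t) is the point at distance t from src e along edge e. *)
Definition point : Type := (nat * R)%type.

Definition valid_point (N : network) (x : point) : Prop :=
  (fst x < nE N)%nat /\ 0 <= snd x <= len N (fst x).

Definition end_cost (N : network) (x : point) (a : nat) (c : R) : Prop :=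
  (a = src N (fst x) /\ c = snd x) \/ (a = dst N (fst x) /\ c = len N (fst x) - snd x).

Definition is_path_len (N : network) (x y : point) (r : R) : Prop :=
  (fst x = fst y /\ r = Rabs (snd x - snd y)) \/
  exists a ca b cb w, end_cost N x a ca /\ end_cost N y b cb /\ walk N a b w /\
                      r = ca + wlen N w + cb.

Definition is_dist (N : network) (x y : point) (r : R) : Prop :=
  is_path_len N x y r /\ forall r', is_path_len N x y r' -> r <= r'.

Definition dist (N : network) (x y : point) : R :=
  epsilon (inhabits 0) (is_dist N x y).

Definition Rleb (a b : R) : bool := if Rle_dec a b then true else false.
Definition Reqb (a b : R) : bool := if Req_EM_T a b then true else false.

(* strategy profiles: player j (j < n) is located at x j *)
Definition profile : Type := nat -> point.

Definition closestb (N : network) (n : nat) (x : profile) (y : point) (j : nat) : bool :=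
  forallb (fun k => Rleb (dist N y (x j)) (dist N y (x k))) (seq 0 n).

Definition sameb (N : network) (x : profile) (j k : nat) : bool :=
  Reqb (dist N (x j) (x k)) 0.

Definition nloc (N : network) (n : nat) (x : profile) (y : point) : nat :=
  length (filter (fun j => andb (closestb N n x y j)
                           (forallb (fun k => negb (sameb N x k j)) (seq 0 j)))
                 (seq 0 n)).

Definition mult (N : network) (n : nat) (x : profile) (i : nat) : nat :=
  length (filter (fun j => sameb N x j i) (seq 0 n)).

Definition share (N : network) (n : nat) (x : profile) (i : nat) (y : point) : R :=
  if closestb N n x y i then / (INR (nloc N n x y) * INR (mult N n x i)) else 0.

Definition payoff (N : network) (n : nat) (x : profile) (i : nat) (r : R) : Prop :=
  exists rs : nat -> R,
    (forall e, (e < nE N)%nat ->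
       exists pr : Riemann_integrable (fun t => share N n x i (e, t)) 0 (len N e),
         RiemannInt pr = rs e) /\
    r = fold_right Rplus 0 (map rs (seq 0 (nE N))).

Definition upd (x : profile) (i : nat) (y : point) : profile :=
  fun j => if Nat.eqb j i then y else x j.

Definition has_pure_NE (N : network) (n : nat) : Prop :=
  exists x : profile,
    (forall i, (i < n)%nat -> valid_point N (x i)) /\
    forall i, (i < n)%nat ->
      exists r, payoff N n x i r /\
        forall y, valid_point N y ->
          exists r', payoff N n (upd x i y) i r' /\ r' <= r.

Definition minlen (N : network) : R :=
  fold_right Rmin (len N 0) (map (len N) (seq 0 (nE N))).

(* ceiling: Int_part is the floor *)
Definition Rceil (x : R) : Z := (- Int_part (- x))%Z.

Definition nbar (N : network) : Z :=
  (3 * Z.of_nat (nE N) +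
   fold_right Z.add 0%Z (map (fun e => Rceil (5 * len N e / minlen N)) (seq 0 (nE N))))%Z.

(* Main.v *)
(** Fix [eta] with [X / eta = 2 n - 4 card(E) - l], where [X] is the total length and [l] the number of
    leaf ends of edges. On each edge the locations are [2 eta] apart, starting from each end vertex, or
    from a pair of players at distance [eta] from a leaf; one shorter gap absorbs the remainder. Each
    edge puts one player on each non-leaf end, so a vertex of degree [d] carries [d] players and controls
    [d * eta]. An inner location whose two gaps are [2 eta] may hold one or two players, which leaves
    enough freedom to use exactly [n] players.

    A player sharing a location earns at least [eta] and finds nothing better: a gap yields at most half
    its length (its full length [eta] next to a leaf), and joining [m] players gives at most
    [(m + 1) eta] to be divided by [m + 1]. A player alone between gaps [g1] and [g2] earns
    [V = (g1 + g2) / 2 >= eta]; her departure merges the two gaps, and the same bounds hold with [V] in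
    place of [eta]. *)

From Stdlib Require Import Reals Lra Lia ZArith Arith List Bool Classical ClassicalEpsilon.
From Coquelicot Require Import Coquelicot.
Require Import Defs.
Open Scope R_scope.
Set Bullet Behavior "Strict Subproofs".

(** * Walks and distances *)

Section Metric.
Context (N : network) (HN : is_network N).

(** The choice of [eta] is a counting device. An edge of length [len] with [l_e] leaf ends takes any
    number of players from [k_e + 4 + l_e] to [2 k_e + 4 + l_e], where [k_e] is the floor of
    [(len / eta - 4 - l_e) / 2]. Summed over the edges, the unrounded values give exactly [n - C]
    with [C = 4 card(E) + l]. Hence, with [K] the sum of the [k_e], the smallest configuration has
    [C + K <= n] players and lacks at most [card(E)], so it remains to know [K >= card(E)]. This is
    where the 5 in [nbar] enters: it gives [X / eta >= 10 X / m >= 10 card(E)], with [m] the least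
    edge length, and rounding down together with [l <= 2 card(E)] then leaves [2 K >= 2 card(E)].
    The same inequality gives [10 eta <= m], so every edge has room for its slots.

    The obstacle is that closeness is measured in the whole network. Occupied non-leaf vertices, and
    occupied points near leaves, confine the competition for a consumer to her own edge. Payoffs are
    then never computed exactly: intervals containing, or contained in, a market area give the
    bounds, and ties between distinct locations need no evaluation. *)

Lemma len_pos e : (e < nE N)%nat -> 0 < len N e.
Proof. intros He. destruct HN as (_ & H & _). apply (H e He). Qed.

Lemma src_neq_dst e : (e < nE N)%nat -> src N e <> dst N e.
Proof. intros He. destruct HN as (_ & H & _). apply (H e He). Qed.

Lemma walk_edges a b w : walk N a b w -> forall e, In e w -> (e < nE N)%nat.
Proof.
  revert a; induction w as [|f w IH]; intros a Hw e He; simpl in *; [easy|].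
  destruct Hw as (Hf & Hw). destruct He as [<-|He]; [easy|].
  destruct Hw as [[_ Hw]|[_ Hw]]; eapply IH; eauto.
Qed.

Lemma walk_app a b c w w' : walk N a b w -> walk N b c w' -> walk N a c (w ++ w').
Proof.
  revert a; induction w as [|f w IH]; intros a Hw Hw'; simpl in *; [now subst|].
  destruct Hw as (Hf & [[H1 H2]|[H1 H2]]); split; auto.
Qed.

Lemma walk_rev a b w : walk N a b w -> walk N b a (rev w).
Proof.
  revert a; induction w as [|f w IH]; intros a Hw; simpl in *; [easy|].
  destruct Hw as (Hf & [[H1 H2]|[H1 H2]]); eapply walk_app; try (apply IH; eassumption);
    simpl; split; auto.
Qed.

Lemma wlen_cons e w : wlen N (e :: w) = len N e + wlen N w.
Proof. reflexivity. Qed.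

Lemma wlen_app w w' : wlen N (w ++ w') = wlen N w + wlen N w'.
Proof.
  induction w as [|e w IH]; simpl; [unfold wlen; simpl; lra|].
  rewrite !wlen_cons, IH; lra.
Qed.

Lemma wlen_rev w : wlen N (rev w) = wlen N w.
Proof.
  induction w as [|e w IH]; simpl; [easy|].
  rewrite wlen_app, IH, !wlen_cons; unfold wlen; simpl; lra.
Qed.

Lemma wlen_nonneg a b w : walk N a b w -> 0 <= wlen N w.
Proof.
  revert a; induction w as [|f w IH]; intros a Hw; [unfold wlen; simpl; lra|].
  rewrite wlen_cons. destruct Hw as (Hf & Hw). pose proof (len_pos f Hf).
  assert (0 <= wlen N w) by (destruct Hw as [[_ H1]|[_ H1]]; eapply IH; eauto). lra.
Qed.

Lemma wlen_tail a b f w : walk N a b (f :: w) -> 0 <= wlen N w.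
Proof. intros (_ & [[_ H]|[_ H]]); eapply wlen_nonneg; eauto. Qed.

Lemma wlen_zero_nil a b w : walk N a b w -> wlen N w <= 0 -> w = nil.
Proof.
  destruct w as [|f w]; intros Hw H; [easy|]. exfalso.
  pose proof (wlen_tail _ _ _ _ Hw). pose proof (len_pos f (proj1 Hw)).
  rewrite wlen_cons in H; lra.
Qed.

Lemma wlen_ge_length m a b w : (forall e, (e < nE N)%nat -> m <= len N e) -> walk N a b w ->
  m * INR (length w) <= wlen N w.
Proof.
  intros Hm; revert a; induction w as [|f w IH]; intros a Hw; [unfold wlen; simpl; lra|].
  rewrite wlen_cons; simpl length; rewrite S_INR.
  destruct Hw as (Hf & Hw). pose proof (Hm f Hf).
  assert (m * INR (length w) <= wlen N w) by (destruct Hw as [[_ H1]|[_ H1]]; eapply IH; eauto).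
  lra.
Qed.

End Metric.

Lemma fold_Rmin_le (l : list R) (a : R) :
  fold_right Rmin a l <= a /\ forall x, In x l -> fold_right Rmin a l <= x.
Proof.
  induction l as [|y l [IH1 IH2]]; simpl; [split; [lra|easy]|].
  pose proof (Rmin_l y (fold_right Rmin a l)). pose proof (Rmin_r y (fold_right Rmin a l)).
  split; [lra|]. intros x [<-|Hx]; [lra|]. specialize (IH2 x Hx); lra.
Qed.

Lemma fold_Rmin_pos (l : list R) (a : R) :
  0 < a -> (forall x, In x l -> 0 < x) -> 0 < fold_right Rmin a l.
Proof.
  intros Ha; induction l as [|y l IH]; simpl; intros H; [easy|].
  apply Rmin_glb_lt; auto.
Qed.

Lemma minlen_le N e : (e < nE N)%nat -> minlen N <= len N e.
Proof.
  intros He. apply (proj2 (fold_Rmin_le _ _)). apply in_map. apply in_seq; lia.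
Qed.

Lemma minlen_pos N : is_network N -> 0 < minlen N.
Proof.
  intros HN. apply fold_Rmin_pos; [apply len_pos; auto; destruct HN; lia|].
  intros x Hx. apply in_map_iff in Hx as (e & <- & He). apply in_seq in He.
  apply len_pos; auto; lia.
Qed.

Lemma list_argmin {A} (P : A -> Prop) (f : A -> R) (l : list A) :
  (exists x, In x l /\ P x) ->
  exists x, In x l /\ P x /\ forall y, In y l -> P y -> f x <= f y.
Proof.
  induction l as [|a l IH]; intros (x & Hx & HP); [easy|].
  destruct (classic (exists x, In x l /\ P x)) as [Hl|Hl].
  - destruct (IH Hl) as (m & Hm & Pm & Hmin).
    destruct (classic (P a /\ f a <= f m)) as [[Pa Ha]|Ha].
    + exists a; repeat split; [now left|easy|].
      intros y [<-|Hy] Py; [lra|]. specialize (Hmin y Hy Py); lra.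
    + exists m; repeat split; [now right|easy|].
      intros y [<-|Hy] Py; [|auto]. apply Rnot_lt_le; intros H; apply Ha; split; [easy|lra].
  - destruct Hx as [<-|Hx]; [|exfalso; eauto].
    exists a; repeat split; [now left|easy|].
    intros y [<-|Hy] Py; [lra|exfalso; eauto].
Qed.

Fixpoint words (m k : nat) : list (list nat) :=
  match k with
  | O => nil :: nil
  | S k => nil :: flat_map (fun w => map (fun e => e :: w) (seq 0 m)) (words m k)
  end.

Lemma words_complete m k w :
  (length w <= k)%nat -> (forall e, In e w -> (e < m)%nat) -> In w (words m k).
Proof.
  revert w; induction k as [|k IH]; intros [|e w] Hl He; simpl in *; try (now left); try lia.
  right. apply in_flat_map. exists w; split.
  - apply IH; [lia|auto].
  - apply in_map_iff. exists e; split; [easy|]. apply in_seq. specialize (He e). lia.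
Qed.

Section Distance.
Context (N : network) (HN : is_network N).

(** There are infinitely many walks, but one no longer than a given [w0] has at most
    [wlen N w0 / minlen N] edges. The minimum is therefore taken over a finite list of words. *)
Lemma shortest_walk a b : (a < nV N)%nat -> (b < nV N)%nat ->
  exists w, walk N a b w /\ forall w', walk N a b w' -> wlen N w <= wlen N w'.
Proof.
  intros Ha Hb. destruct HN as (_ & _ & _ & Hc & _).
  destruct (Hc a b Ha Hb) as (w0 & Hw0).
  pose proof (minlen_pos N HN) as Hm.
  destruct (INR_unbounded (wlen N w0 / minlen N)) as (k & Hk).
  assert (Hsmall : forall w, walk N a b w -> wlen N w <= wlen N w0 -> In w (words (nE N) k)).
  { intros w Hw Hle. apply words_complete; [|eapply walk_edges; eauto].
    apply INR_le. pose proof (wlen_ge_length N (minlen N) a b w (minlen_le N) Hw).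
    apply Rlt_le, (Rle_lt_trans _ (wlen N w0 / minlen N)); [|easy].
    apply Rmult_le_reg_l with (minlen N); [easy|].
    replace (minlen N * (wlen N w0 / minlen N)) with (wlen N w0) by (field; lra). lra. }
  destruct (list_argmin (walk N a b) (wlen N) (words (nE N) k)) as (w & _ & Hw & Hmin).
  { exists w0; split; [|easy]. apply Hsmall; [easy|lra]. }
  exists w; split; [easy|]. intros w' Hw'.
  destruct (Rle_lt_dec (wlen N w') (wlen N w0)) as [H|H]; [auto|].
  assert (wlen N w <= wlen N w0) by (apply Hmin; [apply Hsmall; [easy|lra]|easy]). lra.
Qed.

Lemma end_vertex x a c : valid_point N x -> end_cost N x a c -> (a < nV N)%nat /\ 0 <= c.
Proof.
  intros [Hx Hx'] H. destruct HN as (_ & He & _). specialize (He _ Hx).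
  destruct H as [[-> ->]|[-> ->]]; split; try apply He; lra.
Qed.

Lemma path_len_nonneg x y r : valid_point N x -> valid_point N y -> is_path_len N x y r -> 0 <= r.
Proof.
  intros Hx Hy [[_ ->]|(a & ca & b & cb & w & Ha & Hb & Hw & ->)]; [apply Rabs_pos|].
  pose proof (proj2 (end_vertex x a ca Hx Ha)). pose proof (proj2 (end_vertex y b cb Hy Hb)).
  pose proof (wlen_nonneg N HN a b w Hw). lra.
Qed.

Lemma path_len_min_ends x y a ca b cb : valid_point N x -> valid_point N y ->
  end_cost N x a ca -> end_cost N y b cb ->
  exists r, is_path_len N x y r /\
    forall w, walk N a b w -> r <= ca + wlen N w + cb.
Proof.
  intros Hx Hy Ha Hb.
  destruct (shortest_walk a b) as (w & Hw & Hmin);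
    [apply (end_vertex x a ca Hx Ha)|apply (end_vertex y b cb Hy Hb)|].
  exists (ca + wlen N w + cb); split; [right; exists a, ca, b, cb, w; auto|].
  intros w' Hw'. specialize (Hmin w' Hw'); lra.
Qed.

(** [dist] is an [epsilon], so it means something only once a least path length exists. Five
    candidates suffice: a shortest walk for each choice of an end at [x] and an end at [y], and the
    direct segment, which is a path length only when the two points lie on the same edge. *)
Lemma is_dist_exists x y : valid_point N x -> valid_point N y -> exists r, is_dist N x y r.
Proof.
  intros Hx Hy.
  assert (E : forall z, end_cost N z (src N (fst z)) (snd z) /\
                        end_cost N z (dst N (fst z)) (len N (fst z) - snd z))
    by (intros z; split; [left|right]; auto).
  destruct (E x) as [X1 X2]. destruct (E y) as [Y1 Y2].
  destruct (path_len_min_ends _ _ _ _ _ _ Hx Hy X1 Y1) as (r1 & P1 & M1).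
  destruct (path_len_min_ends _ _ _ _ _ _ Hx Hy X1 Y2) as (r2 & P2 & M2).
  destruct (path_len_min_ends _ _ _ _ _ _ Hx Hy X2 Y1) as (r3 & P3 & M3).
  destruct (path_len_min_ends _ _ _ _ _ _ Hx Hy X2 Y2) as (r4 & P4 & M4).
  destruct (list_argmin (is_path_len N x y) (fun r => r)
    (r1 :: r2 :: r3 :: r4 :: Rabs (snd x - snd y) :: nil)) as (r & _ & Pr & Hmin).
  { exists r1; simpl; auto. }
  exists r; split; [easy|].
  intros r' Hr'. pose proof Hr' as Hr''.
  destruct Hr' as [[H ->]|(a & ca & b & cb & w & Ha & Hb & Hw & ->)].
  - apply Hmin; simpl; auto 10.
  - assert (r <= r1 /\ r <= r2 /\ r <= r3 /\ r <= r4) by (repeat split; apply Hmin; simpl; auto 10).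
    destruct Ha as [[-> ->]|[-> ->]], Hb as [[-> ->]|[-> ->]];
      [specialize (M1 w Hw)|specialize (M2 w Hw)|specialize (M3 w Hw)|specialize (M4 w Hw)]; lra.
Qed.

Lemma dist_spec x y : valid_point N x -> valid_point N y -> is_dist N x y (dist N x y).
Proof. intros Hx Hy. unfold dist. apply epsilon_spec. now apply is_dist_exists. Qed.

Lemma dist_le_path x y r : valid_point N x -> valid_point N y ->
  is_path_len N x y r -> dist N x y <= r.
Proof. intros Hx Hy. exact (proj2 (dist_spec x y Hx Hy) r). Qed.

Lemma dist_path x y : valid_point N x -> valid_point N y -> is_path_len N x y (dist N x y).
Proof. intros Hx Hy. exact (proj1 (dist_spec x y Hx Hy)). Qed.

Lemma dist_nonneg x y : valid_point N x -> valid_point N y -> 0 <= dist N x y.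
Proof. intros Hx Hy. apply (path_len_nonneg x y); auto. now apply dist_path. Qed.

Lemma dist_refl x : valid_point N x -> dist N x x = 0.
Proof.
  intros Hx. apply Rle_antisym; [|now apply dist_nonneg].
  apply dist_le_path; auto. left; split; auto. rewrite Rminus_diag, Rabs_R0; auto.
Qed.

Lemma path_len_sym x y r : is_path_len N x y r -> is_path_len N y x r.
Proof.
  intros [[H ->]|(a & ca & b & cb & w & Ha & Hb & Hw & ->)].
  - left; split; auto. apply Rabs_minus_sym.
  - right; exists b, cb, a, ca, (rev w); repeat split; auto; [now apply walk_rev|].
    rewrite wlen_rev; lra.
Qed.

Lemma dist_sym x y : valid_point N x -> valid_point N y -> dist N x y = dist N y x.
Proof.
  intros Hx Hy. apply Rle_antisym; apply dist_le_path; auto; apply path_len_sym, dist_path; auto.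
Qed.

Lemma end_cost_shift x y a c : fst x = fst y -> end_cost N y a c ->
  exists c', end_cost N x a c' /\ c' <= Rabs (snd x - snd y) + c.
Proof.
  intros E [[-> ->]|[-> ->]].
  - exists (snd x); split; [left; rewrite E; auto|].
    pose proof (Rle_abs (snd x - snd y)); lra.
  - exists (len N (fst x) - snd x); split; [right; rewrite E; auto|].
    rewrite E. rewrite Rabs_minus_sym. pose proof (Rle_abs (snd y - snd x)); lra.
Qed.

Lemma dist_triangle x y z : valid_point N x -> valid_point N y -> valid_point N z ->
  dist N x z <= dist N x y + dist N y z.
Proof.
  intros Hx Hy Hz.
  pose proof (dist_path x y Hx Hy) as P1. pose proof (dist_path y z Hy Hz) as P2.
  destruct P1 as [[E1 ->]|(a & ca & b & cb & w & Ha & Hb & Hw & ->)];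
  destruct P2 as [[E2 ->]|(a' & ca' & b' & cb' & w' & Ha' & Hb' & Hw' & ->)].
  - eapply Rle_trans; [apply dist_le_path; auto; left; split; [congruence|reflexivity]|].
    replace (snd x - snd z) with (snd x - snd y + (snd y - snd z)) by lra. apply Rabs_triang.
  - destruct (end_cost_shift x y a' ca' E1 Ha') as (c & Hc & Hle).
    eapply Rle_trans; [apply dist_le_path; auto; right;
      exists a', c, b', cb', w'; repeat split; eauto|lra].
  - destruct (end_cost_shift z y b cb (eq_sym E2) Hb) as (c & Hc & Hle).
    rewrite Rabs_minus_sym in Hle.
    eapply Rle_trans; [apply dist_le_path; auto; right;
      exists a, ca, b, c, w; repeat split; eauto|lra].
  - pose proof (proj2 (end_vertex _ _ _ Hy Hb)). pose proof (proj2 (end_vertex _ _ _ Hy Ha')).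
    destruct (Nat.eq_dec b a') as [->|Hne].
    + eapply Rle_trans; [apply dist_le_path; auto; right;
        exists a, ca, b', cb', (w ++ w'); repeat split; eauto; eapply walk_app; eauto|].
      rewrite wlen_app; lra.
    (* The two paths reach [y] from opposite ends, so their concatenation crosses the whole edge of
       [y], which is inserted between the walks. *)
    + assert (Hf : walk N b a' (fst y :: nil) /\ cb + ca' = len N (fst y)).
      { simpl. destruct Hy as [Hy _].
        destruct Hb as [[-> ->]|[-> ->]], Ha' as [[-> ->]|[-> ->]]; try congruence;
          (split; [split; auto|lra]). }
      destruct Hf as [Hf Hlen].
      eapply Rle_trans; [apply dist_le_path; auto; right;
        exists a, ca, b', cb', (w ++ (fst y :: nil) ++ w'); repeat split; eauto|].
      * eapply walk_app; eauto. eapply walk_app; eauto.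
      * rewrite !wlen_app. unfold wlen at 2; simpl. lra.
Qed.

Lemma valid_edge e t : (e < nE N)%nat -> 0 <= t <= len N e -> valid_point N (e, t).
Proof. intros He Ht; split; auto. Qed.

Lemma valid_src e : (e < nE N)%nat -> valid_point N (e, 0).
Proof. intros He. pose proof (len_pos N HN e He). apply valid_edge; auto; lra. Qed.

Lemma valid_dst e : (e < nE N)%nat -> valid_point N (e, len N e).
Proof. intros He. pose proof (len_pos N HN e He). apply valid_edge; auto; lra. Qed.

Lemma dist_same_edge_le e s t : valid_point N (e, s) -> valid_point N (e, t) ->
  dist N (e, s) (e, t) <= Rabs (s - t).
Proof. intros Hs Ht. apply dist_le_path; auto. left; auto. Qed.

Lemma dist_via_src e t y : valid_point N (e, t) -> valid_point N y ->
  dist N (e, t) y <= t + dist N (e, 0) y.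
Proof.
  intros Ht Hy. pose proof Ht as [He Ht']; simpl in He, Ht'.
  eapply Rle_trans; [apply dist_triangle with (y := (e, 0)); auto; now apply valid_src|].
  pose proof (dist_same_edge_le e t 0 Ht (valid_src e He)) as H.
  rewrite Rminus_0_r, Rabs_pos_eq in H by lra. lra.
Qed.

Lemma dist_via_dst e t y : valid_point N (e, t) -> valid_point N y ->
  dist N (e, t) y <= len N e - t + dist N (e, len N e) y.
Proof.
  intros Ht Hy. pose proof Ht as [He Ht']; simpl in He, Ht'.
  eapply Rle_trans; [apply dist_triangle with (y := (e, len N e)); auto; now apply valid_dst|].
  pose proof (dist_same_edge_le e t (len N e) Ht (valid_dst e He)) as H.
  rewrite Rabs_minus_sym, Rabs_pos_eq in H by lra. lra.
Qed.

Lemma dist_cases e t y : valid_point N (e, t) -> valid_point N y ->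
  dist N (e, t) y = t + dist N (e, 0) y \/
  dist N (e, t) y = len N e - t + dist N (e, len N e) y \/
  (fst y = e /\ dist N (e, t) y = Rabs (t - snd y)).
Proof.
  intros Ht Hy. pose proof Ht as [He Ht']; simpl in He, Ht'.
  pose proof (dist_via_src e t y Ht Hy) as D0. pose proof (dist_via_dst e t y Ht Hy) as D1.
  destruct (dist_path _ _ Ht Hy) as [[E Ed]|(a & ca & b & cb & w & Ha & Hb & Hw & Ed)];
    simpl in *; [right; right; auto|].
  destruct Ha as [[-> ->]|[-> ->]]; simpl in *.
  - left. apply Rle_antisym; auto. rewrite Ed.
    assert (dist N (e, 0) y <= 0 + wlen N w + cb); [|lra].
    apply dist_le_path; auto; [now apply valid_src|].
    right; exists (src N e), 0, b, cb, w; repeat split; auto. left; auto.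
  - right; left. apply Rle_antisym; auto. rewrite Ed.
    assert (dist N (e, len N e) y <= 0 + wlen N w + cb); [|lra].
    apply dist_le_path; auto; [now apply valid_dst|].
    right; exists (dst N e), 0, b, cb, w; repeat split; auto. right; simpl; split; auto; lra.
Qed.

(** A vertex is represented once on every incident edge, so distance zero, and not equality of
    pairs, is the identity of points of the network. *)
Lemma dist_zero_cases x y : valid_point N x -> valid_point N y -> dist N x y = 0 ->
  x = y \/ exists v, end_cost N x v 0 /\ end_cost N y v 0.
Proof.
  intros Hx Hy H.
  destruct (dist_path _ _ Hx Hy) as [[E Ed]|(a & ca & b & cb & w & Ha & Hb & Hw & Ed)].
  - left. rewrite H in Ed. destruct (Req_dec (snd x - snd y) 0) as [E0|E0];
      [|apply Rabs_pos_lt in E0; lra].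
    destruct x, y; simpl in *. f_equal; auto; lra.
  - right. rewrite H in Ed.
    pose proof (proj2 (end_vertex x a ca Hx Ha)). pose proof (proj2 (end_vertex y b cb Hy Hb)).
    pose proof (wlen_nonneg N HN a b w Hw).
    assert (w = nil) by (eapply wlen_zero_nil; eauto; lra). subst w. simpl in Hw. subst b.
    exists a. replace ca with 0 in Ha by lra. replace cb with 0 in Hb by lra. auto.
Qed.

Lemma dist_zero_vertex x y v : valid_point N x -> valid_point N y ->
  end_cost N x v 0 -> end_cost N y v 0 -> dist N x y = 0.
Proof.
  intros Hx Hy H1 H2. apply Rle_antisym; [|now apply dist_nonneg].
  apply dist_le_path; auto. right. exists v, 0, v, 0, nil. repeat split; auto.
  unfold wlen; simpl; lra.
Qed.

(** An edge is not a loop, so its two ends are different points and each point has at most one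
    position on it. *)
Lemma dist_zero_same_edge e s t : valid_point N (e, s) -> valid_point N (e, t) ->
  dist N (e, s) (e, t) = 0 -> s = t.
Proof.
  intros Hs Ht H. destruct (dist_zero_cases _ _ Hs Ht H) as [E|(v & H1 & H2)]; [congruence|].
  pose proof (src_neq_dst N HN e (proj1 Hs)).
  destruct H1 as [[-> E1]|[-> E1]], H2 as [[E2 E3]|[E2 E3]]; simpl in *; try lra; congruence.
Qed.

Lemma dist_zero_trans x y z : valid_point N x -> valid_point N y -> valid_point N z ->
  dist N x y = 0 -> dist N y z = 0 -> dist N x z = 0.
Proof.
  intros Hx Hy Hz H1 H2. pose proof (dist_triangle x y z Hx Hy Hz).
  pose proof (dist_nonneg x z Hx Hz). lra.
Qed.

End Distance.

(** * Integrability of shares *)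

(** Phrased through pairs of points with no breakpoint between them, so that Boolean combinations
    only require the lists of breakpoints to be merged. *)
Definition locally_constant (a b : R) (l : list R) (P : R -> Prop) : Prop :=
  forall t t', a <= t -> t <= t' -> t' <= b -> (forall c, In c l -> ~ (t <= c <= t')) -> (P t <-> P t').

Definition piecewise_constant (a b : R) (P : R -> Prop) : Prop :=
  exists l, locally_constant a b l P.

Lemma piecewise_constant_ext a b P Q :
  (forall t, a <= t <= b -> (P t <-> Q t)) -> piecewise_constant a b P -> piecewise_constant a b Q.
Proof.
  intros H (l & Hl). exists l. intros t t' H1 H2 H3 H4.
  rewrite <- (H t), <- (H t') by lra. now apply Hl.
Qed.

Lemma locally_constant_incl a b l l' P :
  incl l l' -> locally_constant a b l P -> locally_constant a b l' P.
Proof. intros Hi Hl t t' H1 H2 H3 H4. apply Hl; auto. Qed.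

Lemma piecewise_constant_and a b P Q : piecewise_constant a b P -> piecewise_constant a b Q ->
  piecewise_constant a b (fun t => P t /\ Q t).
Proof.
  intros (l & Hl) (m & Hm). exists (l ++ m). intros t t' H1 H2 H3 H4.
  rewrite (Hl t t'), (Hm t t'); auto; try easy; intros c Hc; apply H4, in_or_app; auto.
Qed.

Lemma piecewise_constant_or a b P Q : piecewise_constant a b P -> piecewise_constant a b Q ->
  piecewise_constant a b (fun t => P t \/ Q t).
Proof.
  intros (l & Hl) (m & Hm). exists (l ++ m). intros t t' H1 H2 H3 H4.
  rewrite (Hl t t'), (Hm t t'); auto; try easy; intros c Hc; apply H4, in_or_app; auto.
Qed.

(** Distances along an edge are minima and maxima of affine functions. An inequality between two
    such functions unfolds into conjunctions and disjunctions of affine inequalities, each of which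
    changes truth value at one point at most. *)
Inductive piecewise_linear : (R -> R) -> Prop :=
| pl_affine p q : piecewise_linear (fun t => p * t + q)
| pl_min u v : piecewise_linear u -> piecewise_linear v -> piecewise_linear (fun t => Rmin (u t) (v t))
| pl_max u v : piecewise_linear u -> piecewise_linear v -> piecewise_linear (fun t => Rmax (u t) (v t)).

Lemma affine_le_piecewise_constant a b p q p' q' :
  piecewise_constant a b (fun t => p * t + q <= p' * t + q').
Proof.
  destruct (Req_dec p p') as [<-|Hp].
  - exists nil. intros t t' _ _ _ _. split; lra.
  - exists ((q' - q) / (p - p') :: nil). intros t t' _ Ht _ Hc.
    specialize (Hc _ (or_introl eq_refl)).
    set (z := (q' - q) / (p - p')) in *.
    assert (Hz : q' = (p - p') * z + q) by (unfold z; field; lra).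
    rewrite Hz.
    assert (z < t \/ t' < z) as Hzt by (destruct (Rle_lt_dec t z), (Rle_lt_dec z t'); auto; exfalso; auto).
    assert (E : forall u, p * u + q <= p' * u + ((p - p') * z + q) <-> (p - p') * (u - z) <= 0)
      by (intros u; split; intros; lra).
    rewrite !E. clear E Hz.
    destruct (Rlt_le_dec p p'); destruct Hzt; split; intros; nra.
Qed.

Lemma Rmin_le_iff a b c : Rmin a b <= c <-> a <= c \/ b <= c.
Proof. unfold Rmin; destruct (Rle_dec a b); lra. Qed.

Lemma le_Rmin_iff a b c : c <= Rmin a b <-> c <= a /\ c <= b.
Proof. unfold Rmin; destruct (Rle_dec a b); lra. Qed.

Lemma Rmax_le_iff a b c : Rmax a b <= c <-> a <= c /\ b <= c.
Proof. unfold Rmax; destruct (Rle_dec a b); lra. Qed.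

Lemma le_Rmax_iff a b c : c <= Rmax a b <-> c <= a \/ c <= b.
Proof. unfold Rmax; destruct (Rle_dec a b); lra. Qed.

Lemma piecewise_linear_le a b u v : piecewise_linear u -> piecewise_linear v ->
  piecewise_constant a b (fun t => u t <= v t).
Proof.
  intros Hu; revert v; induction Hu as [p q|u1 u2 H1 IH1 H2 IH2|u1 u2 H1 IH1 H2 IH2]; intros v Hv.
  - induction Hv as [p' q'|v1 v2 K1 J1 K2 J2|v1 v2 K1 J1 K2 J2].
    + apply affine_le_piecewise_constant.
    + eapply piecewise_constant_ext; [|exact (piecewise_constant_and _ _ _ _ J1 J2)].
      intros; symmetry; apply le_Rmin_iff.
    + eapply piecewise_constant_ext; [|exact (piecewise_constant_or _ _ _ _ J1 J2)].
      intros; symmetry; apply le_Rmax_iff.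
  - eapply piecewise_constant_ext; [|exact (piecewise_constant_or _ _ _ _ (IH1 v Hv) (IH2 v Hv))].
    intros; symmetry; apply Rmin_le_iff.
  - eapply piecewise_constant_ext; [|exact (piecewise_constant_and _ _ _ _ (IH1 v Hv) (IH2 v Hv))].
    intros; symmetry; apply Rmax_le_iff.
Qed.

Lemma common_breakpoints a b {I} (F : I -> R -> Prop) (J : list I) :
  (forall j, In j J -> piecewise_constant a b (F j)) ->
  exists l, forall j, In j J -> locally_constant a b l (F j).
Proof.
  induction J as [|j J IH]; intros H; [exists nil; easy|].
  destruct IH as (l & Hl); [intros; apply H; now right|].
  destruct (H j) as (m & Hm); [now left|].
  exists (m ++ l). intros i [<-|Hi].
  - eapply locally_constant_incl; [|eauto]. apply incl_appl, incl_refl.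
  - eapply locally_constant_incl; [|eauto]. apply incl_appr, incl_refl.
Qed.

Lemma ex_RInt_breakpoints (f : R -> R) (l : list R) a b : a <= b ->
  (forall t t', a < t -> t <= t' -> t' < b -> (forall c, In c l -> ~ (t <= c <= t')) -> f t = f t') ->
  ex_RInt f a b.
Proof.
  revert a b; induction l as [|c l IH]; intros a b Hab H.
  - destruct (Req_dec a b) as [<-|Hne]; [apply ex_RInt_point|].
    apply ex_RInt_ext with (fun _ => f ((a + b) / 2)); [|apply ex_RInt_const].
    rewrite Rmin_left, Rmax_right by lra. intros x Hx.
    destruct (Rle_lt_dec x ((a + b) / 2)); [symmetry|]; apply H; try lra; easy.
  - destruct (classic (a < c < b)) as [Hc|Hc].
    + apply ex_RInt_Chasles with c; apply IH; try lra; intros t t' H1 H2 H3 H4;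
        apply H; try lra; intros d [<-|Hd]; try lra; auto.
    + apply IH; auto. intros t t' H1 H2 H3 H4. apply H; auto.
      intros d [<-|Hd]; [lra|auto].
Qed.

(** * Bounds for integrals and for sums over edges *)

Lemma RInt_const_R (a b c : R) : RInt (fun _ => c) a b = c * (b - a).
Proof. rewrite RInt_const. unfold scal; simpl. unfold Hierarchy.mult; simpl. ring. Qed.

Lemma RInt_le_support (f : R -> R) L lo hi w : ex_RInt f 0 L -> 0 <= lo <= hi -> hi <= L ->
  (forall t, 0 < t < L -> f t <= w) -> (forall t, 0 < t < L -> ~ (lo <= t <= hi) -> f t <= 0) ->
  RInt f 0 L <= w * (hi - lo).
Proof.
  intros Hf Hlo Hhi Hw H0.
  assert (E1 : ex_RInt f 0 lo) by (apply (@ex_RInt_Chasles_1 R_CompleteNormedModule) with L; [lra|auto]).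
  assert (E2 : ex_RInt f lo L) by (apply (@ex_RInt_Chasles_2 R_CompleteNormedModule) with 0; [lra|auto]).
  assert (E3 : ex_RInt f lo hi) by (apply (@ex_RInt_Chasles_1 R_CompleteNormedModule) with L; [lra|auto]).
  assert (E4 : ex_RInt f hi L) by (apply (@ex_RInt_Chasles_2 R_CompleteNormedModule) with lo; [lra|auto]).
  rewrite <- (RInt_Chasles f 0 lo L E1 E2), <- (RInt_Chasles f lo hi L E3 E4).
  assert (I1 : RInt f 0 lo <= RInt (fun _ => 0) 0 lo)
    by (apply RInt_le; [lra|auto|apply ex_RInt_const|intros x Hx; apply H0; try lra; intros ?; lra]).
  assert (I2 : RInt f lo hi <= RInt (fun _ => w) lo hi)
    by (apply RInt_le; [lra|auto; apply ex_RInt_const|auto; apply ex_RInt_const|intros x Hx; apply Hw; lra]).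
  assert (I3 : RInt f hi L <= RInt (fun _ => 0) hi L)
    by (apply RInt_le; [lra|auto|apply ex_RInt_const|intros x Hx; apply H0; try lra; intros ?; lra]).
  rewrite RInt_const_R in I1, I2, I3. unfold Hierarchy.plus; simpl.
  lra.
Qed.

Lemma RInt_ge_support (f : R -> R) L lo hi w : ex_RInt f 0 L -> 0 <= lo <= hi -> hi <= L ->
  (forall t, 0 < t < L -> 0 <= f t) -> (forall t, lo < t < hi -> w <= f t) ->
  w * (hi - lo) <= RInt f 0 L.
Proof.
  intros Hf Hlo Hhi H0 Hw.
  assert (E1 : ex_RInt f 0 lo) by (apply (@ex_RInt_Chasles_1 R_CompleteNormedModule) with L; [lra|auto]).
  assert (E2 : ex_RInt f lo L) by (apply (@ex_RInt_Chasles_2 R_CompleteNormedModule) with 0; [lra|auto]).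
  assert (E3 : ex_RInt f lo hi) by (apply (@ex_RInt_Chasles_1 R_CompleteNormedModule) with L; [lra|auto]).
  assert (E4 : ex_RInt f hi L) by (apply (@ex_RInt_Chasles_2 R_CompleteNormedModule) with lo; [lra|auto]).
  rewrite <- (RInt_Chasles f 0 lo L E1 E2), <- (RInt_Chasles f lo hi L E3 E4).
  assert (I1 : RInt (fun _ => 0) 0 lo <= RInt f 0 lo)
    by (apply RInt_le; [lra|apply ex_RInt_const|auto|intros x Hx; apply H0; lra]).
  assert (I2 : RInt (fun _ => w) lo hi <= RInt f lo hi)
    by (apply RInt_le; [lra|auto; apply ex_RInt_const|auto; apply ex_RInt_const|intros x Hx; apply Hw; lra]).
  assert (I3 : RInt (fun _ => 0) hi L <= RInt f hi L)
    by (apply RInt_le; [lra|apply ex_RInt_const|auto|intros x Hx; apply H0; lra]).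
  rewrite RInt_const_R in I1, I2, I3. unfold Hierarchy.plus; simpl.
  lra.
Qed.

Definition Rsum (g : nat -> R) (l : list nat) : R := fold_right Rplus 0 (map g l).

Lemma Rsum_le_count (g : nat -> R) (p : nat -> bool) C l :
  (forall e, In e l -> g e <= if p e then C else 0) -> Rsum g l <= C * INR (length (filter p l)).
Proof.
  unfold Rsum; induction l as [|e l IH]; intros H; simpl; [lra|].
  pose proof (H e (or_introl eq_refl)) as He.
  assert (fold_right Rplus 0 (map g l) <= C * INR (length (filter p l)))
    by (apply IH; intros; apply H; now right).
  destruct (p e); [simpl length; rewrite S_INR|]; lra.
Qed.

Lemma Rsum_ge_count (g : nat -> R) (p : nat -> bool) C l :
  (forall e, In e l -> (if p e then C else 0) <= g e) -> C * INR (length (filter p l)) <= Rsum g l.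
Proof.
  unfold Rsum; induction l as [|e l IH]; intros H; simpl; [lra|].
  pose proof (H e (or_introl eq_refl)) as He.
  assert (C * INR (length (filter p l)) <= fold_right Rplus 0 (map g l))
    by (apply IH; intros; apply H; now right).
  destruct (p e); [simpl length; rewrite S_INR|]; lra.
Qed.

Lemma Rleb_true a b : Rleb a b = true <-> a <= b.
Proof. unfold Rleb; destruct (Rle_dec a b); split; easy. Qed.

Lemma Reqb_true a b : Reqb a b = true <-> a = b.
Proof. unfold Reqb; destruct (Req_EM_T a b); split; easy. Qed.

Lemma closestb_true N n x y j :
  closestb N n x y j = true <-> forall k, (k < n)%nat -> dist N y (x j) <= dist N y (x k).
Proof.
  unfold closestb. rewrite forallb_forall. split.
  - intros H k Hk. apply Rleb_true, H, in_seq. lia.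
  - intros H k Hk. apply Rleb_true, H. apply in_seq in Hk; lia.
Qed.

Lemma sameb_true N x j k : sameb N x j k = true <-> dist N (x j) (x k) = 0.
Proof. apply Reqb_true. Qed.

Lemma filter_seq_unique (p : nat -> bool) a m j : (a <= j < a + m)%nat -> p j = true ->
  (forall k, (a <= k < a + m)%nat -> p k = true -> k = j) -> length (filter p (seq a m)) = 1%nat.
Proof.
  intros Hj Hp Hu. apply Nat.le_antisymm; change 1%nat with (length (j :: nil)).
  - apply NoDup_incl_length; [apply NoDup_filter, seq_NoDup|].
    intros k Hk. apply filter_In in Hk as [Hk Hk']. apply in_seq in Hk. left. symmetry. auto.
  - apply NoDup_incl_length.
    + repeat constructor. easy.
    + intros k [<-|[]]. apply filter_In; split; auto. now apply in_seq.
Qed.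

Lemma filter_length_mono {A} (p q : A -> bool) l :
  (forall a, In a l -> p a = true -> q a = true) -> (length (filter p l) <= length (filter q l))%nat.
Proof.
  induction l as [|a l IH]; intros H; simpl; [lia|].
  pose proof (H a (or_introl eq_refl)).
  assert (length (filter p l) <= length (filter q l))%nat by (apply IH; intros; apply H; auto; now right).
  destruct (p a), (q a); simpl; lia.
Qed.

(** * Payoffs and their estimates *)

Section Payoffs.
Context (N : network) (HN : is_network N) (n : nat).

Definition valid_profile (x : profile) : Prop := forall j, (j < n)%nat -> valid_point N (x j).

Lemma valid_upd x i y : valid_profile x -> valid_point N y -> valid_profile (upd x i y).
Proof. intros Hx Hy j Hj. unfold upd. destruct (Nat.eqb j i); auto. Qed.

(** The distance is the smaller of the routes through the two ends, together with the direct segment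
    when [y] lies on [e]; the length of that segment is an absolute value, hence a maximum of two
    affine functions. *)
Lemma dist_piecewise_linear e y : (e < nE N)%nat -> valid_point N y ->
  exists u, piecewise_linear u /\ forall t, 0 <= t <= len N e -> dist N (e, t) y = u t.
Proof.
  intros He Hy.
  pose (v := fun t => Rmin (1 * t + dist N (e, 0) y) ((-1) * t + (len N e + dist N (e, len N e) y))).
  pose (w := fun t => Rmax (1 * t + - snd y) ((-1) * t + snd y)).
  assert (Hv : piecewise_linear v) by (apply pl_min; apply pl_affine).
  assert (Hw : piecewise_linear w) by (apply pl_max; apply pl_affine).
  assert (Ew : forall t, w t = Rabs (t - snd y)).
  { intros t. unfold w. unfold Rabs. destruct (Rcase_abs (t - snd y)).
    - rewrite Rmax_right; lra.
    - rewrite Rmax_left; lra. }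
  assert (B : forall t, 0 <= t <= len N e -> dist N (e, t) y <= v t).
  { intros t Ht. pose proof (valid_edge N e t He Ht) as Hv'. unfold v. apply Rmin_glb.
    - pose proof (dist_via_src N HN e t y Hv' Hy); lra.
    - pose proof (dist_via_dst N HN e t y Hv' Hy); lra. }
  destruct (Nat.eq_dec (fst y) e) as [E|E].
  - exists (fun t => Rmin (v t) (w t)). split; [now apply pl_min|].
    intros t Ht. pose proof (valid_edge N e t He Ht) as Hv'.
    apply Rle_antisym.
    + apply Rmin_glb; auto. rewrite Ew. destruct y as [f s]; simpl in *; subst f.
      now apply dist_same_edge_le.
    + apply Rmin_le_iff. rewrite Ew.
      unfold v. rewrite Rmin_le_iff.
      destruct (dist_cases N HN e t y Hv' Hy) as [H|[H|[_ H]]]; rewrite H; lra.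
  - exists v. split; auto. intros t Ht. pose proof (valid_edge N e t He Ht) as Hv'.
    apply Rle_antisym; auto. unfold v. rewrite Rmin_le_iff.
    destruct (dist_cases N HN e t y Hv' Hy) as [H|[H|[H _]]]; [rewrite H; lra|rewrite H; lra|easy].
Qed.

(** Along an edge the share depends on the consumer only through the finitely many comparisons
    between distances to pairs of players, and each comparison is piecewise constant. *)
Lemma share_integrable x i e : valid_profile x -> (i < n)%nat -> (e < nE N)%nat ->
  ex_RInt (fun t => share N n x i (e, t)) 0 (len N e).
Proof.
  intros Hx Hi He. pose proof (len_pos N HN e He) as Hl.
  destruct (common_breakpoints 0 (len N e)
    (fun jk t => dist N (e, t) (x (fst jk)) <= dist N (e, t) (x (snd jk)))
    (list_prod (seq 0 n) (seq 0 n))) as (l & Hlc).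
  { intros [j k] Hjk. apply in_prod_iff in Hjk as [Hj Hk]. apply in_seq in Hj, Hk. simpl.
    destruct (dist_piecewise_linear e (x j) He) as (u & Hu & Eu); [apply Hx; lia|].
    destruct (dist_piecewise_linear e (x k) He) as (v & Hv & Ev); [apply Hx; lia|].
    eapply piecewise_constant_ext; [|apply (piecewise_linear_le _ _ u v Hu Hv)].
    intros t Ht. simpl. rewrite Eu, Ev by auto. easy. }
  apply (ex_RInt_breakpoints _ l); [lra|].
  intros t t' H1 H2 H3 H4.
  assert (Hc : forall j, (j < n)%nat -> closestb N n x (e, t) j = closestb N n x (e, t') j).
  { intros j Hj. apply eq_iff_eq_true. rewrite !closestb_true.
    assert (E : forall k, (k < n)%nat -> (dist N (e, t) (x j) <= dist N (e, t) (x k) <->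
      dist N (e, t') (x j) <= dist N (e, t') (x k))).
    { intros k Hk. apply (Hlc (j, k)); try lra; auto.
      apply in_prod_iff; split; apply in_seq; lia. }
    split; intros H k Hk; apply E; auto. }
  unfold share.
  assert (nloc N n x (e, t) = nloc N n x (e, t')) as ->.
  { unfold nloc. f_equal. apply filter_ext_in. intros j Hj. apply in_seq in Hj.
    rewrite Hc by lia. easy. }
  rewrite Hc by auto. easy.
Qed.

(** The value of the relation [payoff], written with the total function [RInt] so that estimates do
    not carry integrability proofs. *)
Definition total_share (x : profile) (i : nat) : R :=
  Rsum (fun e => RInt (fun t => share N n x i (e, t)) 0 (len N e)) (seq 0 (nE N)).

Lemma payoff_total_share x i : valid_profile x -> (i < n)%nat -> payoff N n x i (total_share x i).
Proof.
  intros Hx Hi. exists (fun e => RInt (fun t => share N n x i (e, t)) 0 (len N e)).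
  split; [|reflexivity]. intros e He.
  exists (ex_RInt_Reals_0 _ _ _ (share_integrable x i e Hx Hi He)).
  symmetry. apply RInt_Reals.
Qed.

Lemma mult_pos x i : valid_profile x -> (i < n)%nat -> (1 <= mult N n x i)%nat.
Proof.
  intros Hx Hi. unfold mult.
  assert (H : In i (filter (fun j => sameb N x j i) (seq 0 n))).
  { apply filter_In; split; [apply in_seq; lia|]. apply sameb_true, dist_refl; auto. }
  destruct (filter _ _); simpl; [easy|lia].
Qed.

Lemma share_le x i y : valid_profile x -> (i < n)%nat -> share N n x i y <= / INR (mult N n x i).
Proof.
  intros Hx Hi. unfold share. pose proof (mult_pos x i Hx Hi) as Hm.
  apply le_INR in Hm; simpl in Hm.
  assert (H0 : 0 < / INR (mult N n x i)) by (apply Rinv_0_lt_compat; lra).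
  destruct (closestb N n x y i); [|lra].
  (* For [nloc] equal to 0 the bound holds because the inverse of 0 is 0. *)
  destruct (nloc N n x y) as [|k].
  - simpl. rewrite Rmult_0_l, Rinv_0. lra.
  - rewrite S_INR. pose proof (pos_INR k). apply Rinv_le_contravar; [lra|]. nra.
Qed.

Lemma share_nonneg x i y : 0 <= share N n x i y.
Proof.
  unfold share. destruct (closestb N n x y i); [|lra].
  assert (0 <= INR (nloc N n x y) * INR (mult N n x i)) as [H|<-]
    by (apply Rmult_le_pos; apply pos_INR).
  - left. now apply Rinv_0_lt_compat.
  - rewrite Rinv_0. lra.
Qed.

(** Some player is closest to [y], and by hypothesis she stands at the location of [i]. So this
    location is closest, and it is the only one. *)
Lemma share_eq x i y : valid_profile x -> valid_point N y -> (i < n)%nat ->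
  (forall j, (j < n)%nat -> closestb N n x y j = true -> dist N (x j) (x i) = 0) ->
  share N n x i y = / INR (mult N n x i).
Proof.
  intros Hx Hy Hi H.
  destruct (list_argmin (fun _ => True) (fun j => dist N y (x j)) (seq 0 n)) as (j0 & Hj0 & _ & Hmin).
  { exists i; split; auto. apply in_seq; lia. }
  apply in_seq in Hj0. destruct Hj0 as [_ Hj0]; simpl in Hj0.
  assert (Hc0 : forall k, (k < n)%nat -> dist N y (x j0) <= dist N y (x k)).
  { intros k Hk. apply Hmin; auto. apply in_seq; lia. }
  assert (Hsame : forall k, (k < n)%nat -> dist N (x k) (x i) = 0 -> closestb N n x y k = true).
  { intros k Hk Hki. apply closestb_true. intros m Hm.
    apply Rle_trans with (dist N y (x j0)); auto.
    pose proof (dist_triangle N HN y (x j0) (x k) Hy (Hx _ Hj0) (Hx _ Hk)).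
    assert (dist N (x j0) (x k) = 0); [|lra].
    apply dist_zero_trans with (x i); auto.
    - apply H; auto. apply closestb_true; auto.
    - rewrite dist_sym; auto. }
  unfold share. rewrite (Hsame i) by (auto; apply dist_refl; auto).
  assert (nloc N n x y = 1%nat) as ->; [|simpl; now rewrite Rmult_1_l].
  (* [nloc] counts each closest location through its player of least index; [m] is that player for
     the location of [i]. *)
  destruct (dec_inh_nat_subset_has_unique_least_element (fun k => (k < n)%nat /\ dist N (x k) (x i) = 0))
    as (m & [[Hm Hmi] Hleast] & _).
  { intros k; apply classic. }
  { exists i; split; auto. apply dist_refl; auto. }
  apply filter_seq_unique with m; [lia| |].
  - apply andb_true_iff; split; auto. apply forallb_forall. intros k Hk. apply in_seq in Hk.
    apply negb_true_iff. apply not_true_iff_false. intros Hkm. apply sameb_true in Hkm.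
    assert (m <= k)%nat; [|lia]. apply Hleast. split; [lia|].
    apply dist_zero_trans with (x m); auto; apply Hx; lia.
  - intros k [_ Hk] Hp. apply andb_true_iff in Hp as [Hk1 Hk2].
    rewrite forallb_forall in Hk2.
    pose proof (H k Hk Hk1) as Hki.
    assert (m <= k)%nat as Hmk by (apply Hleast; auto).
    destruct (Nat.eq_dec k m) as [|Hne]; auto. exfalso.
    specialize (Hk2 m). rewrite in_seq in Hk2.
    assert (negb (sameb N x m k) = true) as Hf by (apply Hk2; lia).
    apply negb_true_iff, not_true_iff_false in Hf. apply Hf, sameb_true.
    apply dist_zero_trans with (x i); auto. rewrite dist_sym; auto.
Qed.

(** Wherever [i] is closest she receives at most the fraction [1 / mult], and ties with other
    locations only lower it. An interval of length at most [W] around her closest set is thus enough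
    on each edge selected by [p]. *)
Lemma total_share_le x i W (p : nat -> bool) : valid_profile x -> (i < n)%nat ->
  (forall e, (e < nE N)%nat -> p e = true -> exists lo hi, 0 <= lo <= hi /\ hi <= len N e /\
     hi - lo <= W /\ forall t, 0 <= t <= len N e -> closestb N n x (e, t) i = true -> lo <= t <= hi) ->
  (forall e, (e < nE N)%nat -> p e = false ->
     forall t, 0 <= t <= len N e -> closestb N n x (e, t) i = false) ->
  total_share x i <= W / INR (mult N n x i) * INR (length (filter p (seq 0 (nE N)))).
Proof.
  intros Hx Hi Hp Hnp. apply Rsum_le_count. intros e He. apply in_seq in He.
  destruct He as [_ He]; simpl in He.
  pose proof (share_integrable x i e Hx Hi He) as Hint. pose proof (len_pos N HN e He) as Hl.
  assert (Hout : forall t, closestb N n x (e, t) i = false -> share N n x i (e, t) <= 0)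
    by (intros t Ht; unfold share; rewrite Ht; lra).
  pose proof (mult_pos x i Hx Hi) as Hm. apply le_INR in Hm; simpl in Hm.
  assert (H0 : 0 < / INR (mult N n x i)) by (apply Rinv_0_lt_compat; lra).
  destruct (p e) eqn:Hpe.
  - destruct (Hp e He Hpe) as (lo & hi & H1 & H2 & H3 & H4).
    eapply Rle_trans; [apply (RInt_le_support _ _ lo hi (/ INR (mult N n x i))); auto|].
    + intros; apply share_le; auto.
    + intros t Ht Hn. apply Hout. apply not_true_iff_false. intros Hc. apply Hn, H4; auto; lra.
    + unfold Rdiv. nra.
  - eapply Rle_trans; [apply (RInt_le_support _ _ 0 0 0); auto; try lra|lra].
    + intros t Ht. apply Hout, Hnp; auto; lra.
    + intros t Ht _. apply Hout, Hnp; auto; lra.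
Qed.

Lemma total_share_ge x i W (p : nat -> bool) : valid_profile x -> (i < n)%nat ->
  (forall e, (e < nE N)%nat -> p e = true -> exists lo hi, 0 <= lo <= hi /\ hi <= len N e /\
     W <= hi - lo /\ forall t, lo < t < hi ->
       forall j, (j < n)%nat -> closestb N n x (e, t) j = true -> dist N (x j) (x i) = 0) ->
  W / INR (mult N n x i) * INR (length (filter p (seq 0 (nE N)))) <= total_share x i.
Proof.
  intros Hx Hi Hp. apply Rsum_ge_count. intros e He. apply in_seq in He.
  destruct He as [_ He]; simpl in He.
  pose proof (share_integrable x i e Hx Hi He) as Hint. pose proof (len_pos N HN e He) as Hl.
  pose proof (mult_pos x i Hx Hi) as Hm. apply le_INR in Hm; simpl in Hm.
  assert (H0 : 0 < / INR (mult N n x i)) by (apply Rinv_0_lt_compat; lra).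
  destruct (p e) eqn:Hpe.
  - destruct (Hp e He Hpe) as (lo & hi & H1 & H2 & H3 & H4).
    eapply Rle_trans; [|apply (RInt_ge_support _ _ lo hi (/ INR (mult N n x i))); auto].
    + unfold Rdiv. nra.
    + intros; apply share_nonneg.
    + intros t Ht. right; symmetry.
      apply share_eq; auto; [apply valid_edge; auto; lra|exact (H4 t Ht)].
  - replace 0 with (0 * (0 - 0)) at 1 by ring.
    apply (RInt_ge_support _ _ 0 0 0); auto; try lra; intros; apply share_nonneg.
Qed.

End Payoffs.

(** * Deviations *)

Definition incident (N : network) (v e : nat) : bool := Nat.eqb (src N e) v || Nat.eqb (dst N e) v.

Definition leafb (N : network) (v : nat) : bool := Nat.eqb (degree N v) 1.

Lemma incident_spec N v e : incident N v e = true <-> src N e = v \/ dst N e = v.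
Proof. unfold incident. rewrite orb_true_iff, !Nat.eqb_eq. easy. Qed.

Lemma end_cost_incident N e t v c : end_cost N (e, t) v c -> incident N v e = true.
Proof. rewrite incident_spec. intros [[-> _]|[-> _]]; auto. Qed.

Lemma leaf_unique_edge N v e f : leafb N v = true -> (e < nE N)%nat -> (f < nE N)%nat ->
  incident N v e = true -> incident N v f = true -> e = f.
Proof.
  intros Hv He Hf Ie If. apply Nat.eqb_eq in Hv. unfold degree in Hv.
  change (length (filter (incident N v) (seq 0 (nE N))) = 1%nat) in Hv.
  assert (In e (filter (incident N v) (seq 0 (nE N)))) as Je
    by (apply filter_In; split; auto; apply in_seq; lia).
  assert (In f (filter (incident N v) (seq 0 (nE N)))) as Jf
    by (apply filter_In; split; auto; apply in_seq; lia).
  destruct (filter _ _) as [|g [|h l]]; simpl in Hv; try easy.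
  destruct Je as [<-|[]], Jf as [<-|[]]; auto.
Qed.

Section Nearest.
Context (N : network) (HN : is_network N).

Lemma dist_from_leaf e t y v : valid_point N (e, t) -> valid_point N y ->
  end_cost N (e, t) v 0 -> leafb N v = true ->
  (fst y = e /\ Rabs (t - snd y) <= dist N (e, t) y) \/ len N e <= dist N (e, t) y.
Proof.
  intros Ht Hy Hv Hleaf. pose proof Ht as [He Ht']; simpl in He, Ht'.
  pose proof (len_pos N HN e He) as Hl. pose proof (src_neq_dst N HN e He) as Hne.
  destruct (dist_path N HN _ _ Ht Hy) as [[E Ed]|(a & ca & b & cb & w & Ha & Hb & Hw & Ed)];
    simpl in *; [left; split; auto; lra|].
  pose proof (proj2 (end_vertex N HN _ _ _ Hy Hb)) as Hcb.
  pose proof (proj2 (end_vertex N HN _ _ _ Ht Ha)) as Hca.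
  pose proof (wlen_nonneg N HN _ _ _ Hw) as Hwn.
  destruct (Nat.eq_dec a v) as [->|Hav].
  - destruct w as [|f w].
    + left. simpl in Hw; subst b. destruct y as [f s]; simpl.
      assert (f = e) as ->.
      { apply leaf_unique_edge with N v; auto; [apply Hy|eapply end_cost_incident; eauto|
        eapply end_cost_incident; eauto]. }
      split; auto. rewrite Ed. unfold wlen; simpl.
      unfold end_cost in *; simpl in *. destruct Hy as [_ Hy]; simpl in Hy.
      destruct Hv as [[Hv1 Hv2]|[Hv1 Hv2]], Hb as [[Hb1 Hb2]|[Hb1 Hb2]]; try congruence.
      * rewrite Rabs_minus_sym, Rabs_pos_eq; lra.
      * rewrite Rabs_pos_eq; lra.
    + right. pose proof (wlen_tail N HN _ _ _ _ Hw) as Htl.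
      assert (f = e) as ->.
      { apply leaf_unique_edge with N v; auto; [apply Hw| |eapply end_cost_incident; eauto].
        apply incident_spec. destruct Hw as (_ & [[-> _]|[-> _]]); auto. }
      rewrite wlen_cons in Ed. lra.
  - right. unfold end_cost in Ha, Hv; simpl in Ha, Hv.
    destruct Hv as [[Hv1 Hv2]|[Hv1 Hv2]], Ha as [[Ha1 Ha2]|[Ha1 Ha2]]; try congruence; lra.
Qed.

Definition guarded (e : nat) (O : R -> Prop) : Prop :=
  (if leafb N (src N e) then exists a, O a /\ 0 <= a < len N e else O 0) /\
  (if leafb N (dst N e) then exists a, O a /\ 0 < a <= len N e else O (len N e)).

(* A shortest path leaving the edge [e] through an end vertex passes either an occupied vertex or
   turns around at a leaf, behind an occupied point. So a nearest occupied location lies on [e]. *)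
Lemma nearest_on_edge e t y (O : R -> Prop) : valid_point N (e, t) -> valid_point N y ->
  guarded e O -> (forall a, 0 <= a <= len N e -> O a -> dist N (e, t) y <= Rabs (t - a)) ->
  exists s, 0 <= s <= len N e /\ dist N (e, s) y = 0 /\ Rabs (t - s) <= dist N (e, t) y.
Proof.
  intros Ht Hy [Hs Hd] Hnear. pose proof Ht as [He Ht']; simpl in He, Ht'.
  pose proof (len_pos N HN e He) as Hl.
  pose proof (valid_src N HN e He) as V0. pose proof (valid_dst N HN e He) as V1.
  assert (Hself : fst y = e -> Rabs (t - snd y) <= dist N (e, t) y ->
    exists s, 0 <= s <= len N e /\ dist N (e, s) y = 0 /\ Rabs (t - s) <= dist N (e, t) y).
  { intros E H. exists (snd y). destruct y as [f s]; simpl in *; subst f.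
    split; [apply Hy|]. split; auto. now apply dist_refl. }
  destruct (dist_cases N HN e t y Ht Hy) as [H|[H|[E H]]].
  - pose proof (dist_nonneg N HN _ _ V0 Hy) as Hp.
    destruct (leafb N (src N e)) eqn:Hleaf.
    + destruct (dist_from_leaf e 0 y (src N e) V0 Hy) as [[E Hf]|Hf]; auto.
      * left; auto.
      * apply Hself; auto. destruct Hy as [_ Hy].
        rewrite Rminus_0_l, Rabs_Ropp, Rabs_pos_eq in Hf by lra.
        unfold Rabs; destruct (Rcase_abs _); lra.
      * destruct Hs as (a & Oa & Ha). specialize (Hnear a). revert Hnear.
        unfold Rabs; destruct (Rcase_abs _); intros Hnear; specialize (Hnear ltac:(lra) Oa); lra.
    + specialize (Hnear 0 ltac:(lra) Hs). rewrite Rminus_0_r, Rabs_pos_eq in Hnear by lra.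
      exists 0. split; [lra|]. split; [lra|]. rewrite Rminus_0_r, Rabs_pos_eq by lra. lra.
  - pose proof (dist_nonneg N HN _ _ V1 Hy) as Hp.
    destruct (leafb N (dst N e)) eqn:Hleaf.
    + destruct (dist_from_leaf e (len N e) y (dst N e) V1 Hy) as [[E Hf]|Hf]; auto.
      * right; simpl; split; auto; lra.
      * apply Hself; auto. destruct Hy as [_ Hy]. rewrite E in Hy.
        rewrite Rabs_pos_eq in Hf by lra.
        unfold Rabs; destruct (Rcase_abs _); lra.
      * destruct Hd as (a & Oa & Ha). specialize (Hnear a). revert Hnear.
        unfold Rabs; destruct (Rcase_abs _); intros Hnear; specialize (Hnear ltac:(lra) Oa); lra.
    + specialize (Hnear (len N e) ltac:(lra) Hd).
      rewrite Rabs_minus_sym, Rabs_pos_eq in Hnear by lra.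
      exists (len N e). split; [lra|]. split; [lra|]. rewrite Rabs_minus_sym, Rabs_pos_eq by lra. lra.
  - apply Hself; auto. lra.
Qed.

End Nearest.

(* [O] is the set of occupied positions on an edge of length [len]: a player at [s] attracts at most
   [W] there in [reach], and at least [W] together with her co-located players in [owns]. *)
Definition reach (len : R) (O : R -> Prop) (s W : R) : Prop :=
  exists lo hi, 0 <= lo <= hi /\ hi <= len /\ hi - lo <= W /\
    forall t, 0 <= t <= len -> (forall a, 0 <= a <= len -> O a -> Rabs (t - s) <= Rabs (t - a)) ->
      lo <= t <= hi.

Definition owns (len : R) (O : R -> Prop) (s W : R) : Prop :=
  exists lo hi, 0 <= lo <= hi /\ hi <= len /\ W <= hi - lo /\
    forall t, lo < t < hi -> forall s', 0 <= s' <= len -> O s' -> Rabs (t - s') <= Rabs (t - s) -> s' = s.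

Record deviation_proof (N : network) (e : nat) (V : R) (O : R -> Prop) : Prop := {
  dp_guarded : guarded N e O;
  dp_src : leafb N (src N e) = false -> reach (len N e) O 0 V;
  dp_dst : leafb N (dst N e) = false -> reach (len N e) O (len N e) V;
  dp_free : forall s, 0 <= s <= len N e -> ~ O s -> reach (len N e) O s V;
  dp_occupied : forall s, 0 < s < len N e -> O s -> reach (len N e) O s (2 * V)
}.

Lemma deviation_proof_ext N e V (O O' : R -> Prop) : (forall a, O a <-> O' a) ->
  deviation_proof N e V O -> deviation_proof N e V O'.
Proof.
  intros HO [[G1 G2] D1 D2 D3 D4].
  assert (Hr : forall s W, reach (len N e) O s W -> reach (len N e) O' s W).
  { intros s W (lo & hi & H1 & H2 & H3 & H4). exists lo, hi. repeat (split; auto).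
    - apply H4; auto. intros a Ha Oa. apply H0; auto. now apply HO.
    - apply H4; auto. intros a Ha Oa. apply H0; auto. now apply HO. }
  constructor; auto.
  - split; [destruct (leafb N (src N e))|destruct (leafb N (dst N e))]; try (now apply HO);
      [destruct G1 as (a & Oa & Ha)|destruct G2 as (a & Oa & Ha)]; exists a; split; auto; now apply HO.
  - intros s Hs Os. apply Hr, D3; auto. rewrite HO; auto.
  - intros s Hs Os. apply Hr, D4; auto. now apply HO.
Qed.

Definition multiplicity (p : R) (l : list R) : nat := count_occ Req_EM_T l p.

Record edge_balanced (N : network) (eta : R) (L : list R) (e : nat) : Prop := {
  eb_range : forall p, In p L -> 0 <= p <= len N e;
  eb_src : if leafb N (src N e) then ~ In 0 L else
    multiplicity 0 L = 1%nat /\ owns (len N e) (fun a => In a L) 0 eta;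
  eb_dst : if leafb N (dst N e) then ~ In (len N e) L else
    multiplicity (len N e) L = 1%nat /\ owns (len N e) (fun a => In a L) (len N e) eta;
  eb_inner : forall p, In p L -> 0 < p < len N e ->
    (multiplicity p L = 2%nat /\ owns (len N e) (fun a => In a L) p (2 * eta)) \/
    (multiplicity p L = 1%nat /\ exists V, eta <= V /\ owns (len N e) (fun a => In a L) p V /\
       deviation_proof N e V (fun a => In a L /\ a <> p));
  eb_all : forall V, eta <= V -> deviation_proof N e V (fun a => In a L)
}.

Definition config_points (N : network) (L : nat -> list R) : list point :=
  flat_map (fun e => map (fun p => (e, p)) (L e)) (seq 0 (nE N)).

Lemma in_config_points N L e p :
  In (e, p) (config_points N L) <-> (e < nE N)%nat /\ In p (L e).
Proof.
  unfold config_points. rewrite in_flat_map. split.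
  - intros (f & Hf & Hp). apply in_seq in Hf. apply in_map_iff in Hp as (q & E & Hq).
    inversion E; subst. split; [lia|auto].
  - intros [He Hp]. exists e. split; [apply in_seq; lia|]. apply in_map_iff. eauto.
Qed.

Lemma filter_map_length {A B} (f : A -> B) (p : B -> bool) l :
  length (filter p (map f l)) = length (filter (fun a => p (f a)) l).
Proof. induction l as [|a l IH]; simpl; auto. destruct (p (f a)); simpl; auto. Qed.

Lemma filter_flat_map_length {A B} (F : A -> list B) (p : B -> bool) (q : A -> bool) c l :
  (forall a, In a l -> length (filter p (F a)) = if q a then c else 0%nat) ->
  length (filter p (flat_map F l)) = (c * length (filter q l))%nat.
Proof.
  induction l as [|a l IH]; intros H; simpl; [lia|].
  rewrite filter_app, length_app, (H a (or_introl eq_refl)), IH by (intros; apply H; now right).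
  destruct (q a); simpl; lia.
Qed.

Lemma filter_multiplicity (p : R -> bool) s l : (forall a, In a l -> (p a = true <-> a = s)) ->
  length (filter p l) = multiplicity s l.
Proof.
  unfold multiplicity. induction l as [|a l IH]; intros H; simpl; auto.
  pose proof (H a (or_introl eq_refl)) as Ha.
  rewrite <- IH by (intros; apply H; now right).
  destruct (p a), (Req_EM_T a s); simpl; auto; exfalso.
  - apply n, Ha; auto.
  - apply Ha in e. easy.
Qed.

Lemma filter_none_length {A} (p : A -> bool) l : (forall a, In a l -> p a = false) ->
  length (filter p l) = 0%nat.
Proof.
  induction l as [|a l IH]; intros H; simpl; auto.
  rewrite (H a (or_introl eq_refl)). apply IH; intros; apply H; now right.
Qed.

Lemma filter_eqb_seq m f : (f < m)%nat -> length (filter (fun e => Nat.eqb e f) (seq 0 m)) = 1%nat.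
Proof.
  intros Hf. apply filter_seq_unique with f; [lia|apply Nat.eqb_refl|].
  intros k _ Hk. now apply Nat.eqb_eq.
Qed.

Section Equilibrium.
Context (N : network) (HN : is_network N) (eta : R) (Heta : 0 < eta) (L : nat -> list R).
Context (HL : forall e, (e < nE N)%nat -> edge_balanced N eta (L e) e).

Let pts := config_points N L.
Let n := length pts.
Let x : profile := fun j => nth j pts (0%nat, 0).

Lemma config_player e p : (e < nE N)%nat -> In p (L e) -> exists j, (j < n)%nat /\ x j = (e, p).
Proof.
  intros He Hp. assert (In (e, p) pts) as H by (apply in_config_points; auto).
  apply (In_nth _ _ (0%nat, 0)) in H as (j & Hj & E). exists j; auto.
Qed.

Lemma player_config j : (j < n)%nat ->
  (fst (x j) < nE N)%nat /\ In (snd (x j)) (L (fst (x j))).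
Proof.
  intros Hj. assert (In (x j) pts) as H by (apply nth_In; auto).
  rewrite (surjective_pairing (x j)) in H. now apply in_config_points in H.
Qed.

Lemma config_valid : valid_profile N n x.
Proof.
  intros j Hj. destruct (player_config j Hj) as [He Hp].
  split; auto. now apply (eb_range _ _ _ _ (HL _ He)).
Qed.

Definition crowd (y : point) : nat := length (filter (fun q => Reqb (dist N q y) 0) pts).

Lemma map_nth_seq {A} (l : list A) d : map (fun j => nth j l d) (seq 0 (length l)) = l.
Proof.
  induction l as [|a l IH]; simpl; auto. f_equal. rewrite <- seq_shift, map_map. exact IH.
Qed.

Lemma crowd_filter y : crowd y = length (filter (fun j => Reqb (dist N (x j) y) 0) (seq 0 n)).
Proof.
  unfold crowd. rewrite <- (map_nth_seq pts (0%nat, 0)) at 1. apply filter_map_length.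
Qed.

Lemma mult_crowd i : mult N n x i = crowd (x i).
Proof. rewrite crowd_filter. reflexivity. Qed.

Lemma crowd_le_mult_upd i y : valid_point N y -> (crowd y <= mult N n (upd x i y) i)%nat.
Proof.
  intros Hy. rewrite crowd_filter. apply filter_length_mono. intros j Hj H.
  apply Reqb_true in H. apply sameb_true. unfold upd. rewrite Nat.eqb_refl.
  destruct (Nat.eqb j i); auto. now apply dist_refl.
Qed.

Lemma two_players z i j : valid_profile N n z -> (i < n)%nat -> (j < n)%nat -> j <> i ->
  dist N (z j) (z i) = 0 -> (2 <= mult N n z i)%nat.
Proof.
  intros Hz Hi Hj Hne H. change 2%nat with (length (i :: j :: nil)).
  apply NoDup_incl_length.
  - constructor; [intros [E|[]]; auto|]. repeat constructor. easy.
  - intros k [<-|[<-|[]]]; apply filter_In; (split; [apply in_seq; lia|]); apply sameb_true; auto.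
    apply dist_refl; auto.
Qed.

Lemma partner i : (i < n)%nat -> (2 <= mult N n x i)%nat ->
  exists j, (j < n)%nat /\ j <> i /\ dist N (x j) (x i) = 0.
Proof.
  intros Hi H. apply NNPP. intros Hno.
  assert (mult N n x i = 1%nat); [|lia].
  apply filter_seq_unique with i; [lia| |].
  - apply sameb_true, dist_refl; auto. now apply config_valid.
  - intros k [_ Hk] Hs. apply NNPP. intros Hne. apply Hno. exists k.
    apply sameb_true in Hs. auto.
Qed.

Definition off_vertex (y : point) : Prop :=
  (snd y = 0 -> leafb N (src N (fst y)) = true) /\
  (snd y = len N (fst y) -> leafb N (dst N (fst y)) = true).

Definition at_vertex (y : point) (v : nat) : Prop := leafb N v = false /\ end_cost N y v 0.

Lemma vertex_or_off y : off_vertex y \/ exists v, at_vertex y v.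
Proof.
  destruct (classic (off_vertex y)) as [|H]; auto. right.
  apply not_and_or in H as [H|H]; apply imply_to_and in H as [H1 H2];
    apply not_true_is_false in H2.
  - exists (src N (fst y)). split; auto. left; auto.
  - exists (dst N (fst y)). split; auto. right; split; auto; lra.
Qed.

Lemma off_vertex_position y e s : valid_point N y -> valid_point N (e, s) -> off_vertex y ->
  dist N (e, s) y = 0 -> y = (e, s).
Proof.
  intros Hy Hs [H1 H2] H0.
  destruct (dist_zero_cases N HN _ _ Hs Hy H0) as [E|(v & E1 & E2)]; auto.
  destruct y as [f t]; simpl in *.
  assert (f = e) as ->.
  { assert (leafb N v = true).
    { unfold end_cost in E2; simpl in E2. destruct E2 as [[-> E]|[-> E]]; [apply H1|apply H2]; lra. }
    apply leaf_unique_edge with N v; auto; [apply Hy|apply Hs|eapply end_cost_incident; eauto|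
      eapply end_cost_incident; eauto]. }
  f_equal. symmetry. eapply dist_zero_same_edge; eauto.
Qed.

Lemma vertex_not_incident y v e s : valid_point N y -> valid_point N (e, s) -> at_vertex y v ->
  dist N (e, s) y = 0 -> incident N v e = true.
Proof.
  intros Hy Hs [_ Hv] H0. pose proof (dist_zero_cases N HN _ _ Hs Hy H0) as C.
  destruct C as [<-|(w & E1 & E2)].
  - eapply end_cost_incident; eauto.
  - replace v with w; [eapply end_cost_incident; eauto|].
    pose proof (len_pos N HN _ (proj1 Hy)). 
    destruct E2 as [[-> E2]|[-> E2]], Hv as [[-> E3]|[-> E3]]; auto; lra.
Qed.

Lemma vertex_end y v e : valid_point N y -> (e < nE N)%nat -> at_vertex y v -> incident N v e = true ->
  exists s, dist N (e, s) y = 0 /\ ((s = 0 /\ src N e = v) \/ (s = len N e /\ dst N e = v)) /\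
    valid_point N (e, s).
Proof.
  intros Hy He [_ Hv] Hi. apply incident_spec in Hi.
  pose proof (valid_src N HN e He). pose proof (valid_dst N HN e He).
  destruct Hi as [Hi|Hi].
  - exists 0. repeat split; auto; try apply H. eapply dist_zero_vertex; eauto. left; auto.
  - exists (len N e). repeat split; auto; try apply H0. eapply dist_zero_vertex; eauto.
    right; simpl; split; auto; lra.
Qed.

Lemma crowd_off_vertex y : valid_point N y -> off_vertex y ->
  crowd y = multiplicity (snd y) (L (fst y)).
Proof.
  intros Hy Hoff. unfold crowd, pts, config_points.
  rewrite (filter_flat_map_length _ _ (fun e => Nat.eqb e (fst y))
    (multiplicity (snd y) (L (fst y)))).
  - rewrite filter_eqb_seq by apply Hy. lia.
  - intros e He. apply in_seq in He. destruct He as [_ He]; simpl in He.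
    rewrite filter_map_length.
    assert (Hval : forall p, In p (L e) -> valid_point N (e, p)).
    { intros p Hp. split; auto. now apply (eb_range _ _ _ _ (HL e He)). }
    destruct (Nat.eqb_spec e (fst y)) as [->|Hne].
    + apply filter_multiplicity. intros p Hp. rewrite Reqb_true. split.
      * intros H. apply off_vertex_position in H; auto. now rewrite H.
      * intros ->. rewrite <- surjective_pairing. now apply dist_refl.
    + apply filter_none_length. intros p Hp. apply not_true_is_false. rewrite Reqb_true.
      intros H. apply off_vertex_position in H; auto. apply Hne. now rewrite H.
Qed.

Lemma crowd_vertex y v : valid_point N y -> at_vertex y v ->
  crowd y = length (filter (incident N v) (seq 0 (nE N))).
Proof.
  intros Hy Hv. unfold crowd, pts, config_points.
  rewrite (filter_flat_map_length _ _ (incident N v) 1); [lia|].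
  intros e He. apply in_seq in He. destruct He as [_ He]; simpl in He.
  rewrite filter_map_length.
  assert (Hval : forall p, In p (L e) -> valid_point N (e, p)).
  { intros p Hp. split; auto. now apply (eb_range _ _ _ _ (HL e He)). }
  destruct (incident N v e) eqn:Hi.
  - destruct (vertex_end y v e Hy He Hv Hi) as (s & Hs & Hend & Vs).
    rewrite (filter_multiplicity _ s).
    + destruct Hv as [Hv _]. destruct Hend as [[-> <-]|[-> <-]].
      * pose proof (eb_src _ _ _ _ (HL e He)) as Hsrc. rewrite Hv in Hsrc. apply Hsrc.
      * pose proof (eb_dst _ _ _ _ (HL e He)) as Hdst. rewrite Hv in Hdst. apply Hdst.
    + intros p Hp. rewrite Reqb_true. split; [|intros ->; auto]. intros H.
      eapply dist_zero_same_edge; eauto. eapply dist_zero_trans with (y := y); eauto.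
      rewrite dist_sym; auto.
  - apply filter_none_length. intros p Hp. apply not_true_is_false. rewrite Reqb_true.
    intros H. rewrite (vertex_not_incident y v e p) in Hi; auto.
Qed.

Lemma closest_nearest z e t j (O : R -> Prop) : valid_profile N n z -> (j < n)%nat ->
  valid_point N (e, t) -> guarded N e O ->
  (forall a, 0 <= a <= len N e -> O a -> exists k, (k < n)%nat /\ dist N (e, a) (z k) = 0) ->
  closestb N n z (e, t) j = true ->
  exists s, 0 <= s <= len N e /\ dist N (e, s) (z j) = 0 /\
    forall a, 0 <= a <= len N e -> O a -> Rabs (t - s) <= Rabs (t - a).
Proof.
  intros Hz Hj Ht Hg HO Hc. pose proof (proj1 (closestb_true N n z (e, t) j) Hc) as Hc'.
  assert (Hb : forall a, 0 <= a <= len N e -> O a -> dist N (e, t) (z j) <= Rabs (t - a)).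
  { intros a Ha Oa. destruct (HO a Ha Oa) as (k & Hk & Hd).
    eapply Rle_trans; [apply Hc'; eauto|].
    assert (valid_point N (e, a)) by (apply valid_edge; auto; apply Ht).
    eapply Rle_trans; [apply dist_triangle with (y := (e, a)); auto|].
    rewrite Hd, Rplus_0_r. now apply dist_same_edge_le. }
  destruct (nearest_on_edge N HN e t (z j) O Ht (Hz j Hj) Hg Hb) as (s & Hs & Hd & Hle).
  exists s. split; auto. split; auto. intros a Ha Oa. specialize (Hb a Ha Oa). lra.
Qed.

(* [O e] may omit the old location of player [i], when she was alone there. *)
Lemma deviation_bound i V (O : nat -> R -> Prop) y : (i < n)%nat -> 0 < V -> valid_point N y ->
  (forall e, (e < nE N)%nat -> deviation_proof N e V (O e)) ->
  (forall e a, (e < nE N)%nat -> O e a -> In a (L e)) ->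
  (forall e a, (e < nE N)%nat -> O e a -> exists j, (j < n)%nat /\ j <> i /\ dist N (e, a) (x j) = 0) ->
  total_share N n (upd x i y) i <= V.
Proof.
  intros Hi HV Hy HO HOL HOx. set (z := upd x i y).
  assert (Hzi : z i = y) by (unfold z, upd; now rewrite Nat.eqb_refl).
  assert (Hz : valid_profile N n z) by (apply valid_upd; auto; apply config_valid).
  assert (HOz : forall e a, (e < nE N)%nat -> O e a -> exists j, (j < n)%nat /\ j <> i /\ dist N (e, a) (z j) = 0).
  { intros e a He Oa. destruct (HOx e a He Oa) as (j & Hj & Hne & Hd). exists j.
    unfold z, upd. rewrite (proj2 (Nat.eqb_neq j i) Hne). auto. }
  assert (Hnear : forall e t, (e < nE N)%nat -> 0 <= t <= len N e -> closestb N n z (e, t) i = true ->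
    exists s, 0 <= s <= len N e /\ dist N (e, s) y = 0 /\
      forall a, 0 <= a <= len N e -> O e a -> Rabs (t - s) <= Rabs (t - a)).
  { intros e t He Ht Hc. rewrite <- Hzi. eapply closest_nearest; eauto.
    - now apply valid_edge.
    - apply dp_guarded with V; auto.
    - intros a _ Oa. destruct (HOz e a He Oa) as (j & Hj & _ & Hd). eauto. }
  pose proof (mult_pos N HN n z i Hz Hi) as Hm.
  apply le_INR in Hm; simpl in Hm.
  destruct (vertex_or_off y) as [Hoff|(v & Hv)].
  - assert (Hpos : forall e t, (e < nE N)%nat -> 0 <= t <= len N e -> closestb N n z (e, t) i = true ->
      e = fst y /\ forall a, 0 <= a <= len N e -> O e a -> Rabs (t - snd y) <= Rabs (t - a)).
    { intros e t He Ht Hc. destruct (Hnear e t He Ht Hc) as (s & Hs & Hd & Hle).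
      apply off_vertex_position in Hd; auto; [|now apply valid_edge]. rewrite Hd; auto. }
    assert (Hbound : forall W, reach (len N (fst y)) (O (fst y)) (snd y) W ->
      total_share N n z i <= W / INR (mult N n z i)).
    { intros W (lo & hi & H1 & H2 & H3 & H4).
      eapply Rle_trans; [apply (total_share_le N HN n z i W (fun e => Nat.eqb e (fst y))); auto|].
      - intros e He E. apply Nat.eqb_eq in E. subst e.
        exists lo, hi. repeat split; auto; try lra; apply H4; auto; apply Hpos; auto.
      - intros e He E t Ht. apply not_true_is_false. intros Hc. apply Hpos in Hc; auto.
        destruct Hc as [Hc _]. apply Nat.eqb_neq in E. easy.
      - rewrite filter_eqb_seq by apply Hy. simpl. lra. }
    destruct Hy as [Hy1 Hy2]. pose proof (HO _ Hy1) as HD.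
    destruct (classic (O (fst y) (snd y))) as [Oy|Oy].
    + assert (Hs : 0 < snd y < len N (fst y)).
      { pose proof (HOL _ _ Hy1 Oy) as Hin. destruct Hoff as [Hoff1 Hoff2].
        pose proof (eb_src _ _ _ _ (HL _ Hy1)) as Hsrc. pose proof (eb_dst _ _ _ _ (HL _ Hy1)) as Hdst.
        split.
        - destruct (proj1 Hy2) as [|E]; auto. exfalso. symmetry in E. rewrite (Hoff1 E), <- E in Hsrc. auto.
        - destruct (proj2 Hy2) as [|E]; auto. exfalso. rewrite (Hoff2 E), <- E in Hdst. auto. }
      eapply Rle_trans; [apply Hbound, (dp_occupied _ _ _ _ HD); auto|].
      destruct (HOz _ _ Hy1 Oy) as (j & Hj & Hne & Hd).
      rewrite <- surjective_pairing, <- Hzi in Hd.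
      assert (2 <= mult N n z i)%nat as H2.
      { apply two_players with j; auto. rewrite dist_sym; auto. }
      apply le_INR in H2; simpl in H2.
      apply Rmult_le_reg_r with (INR (mult N n z i)); [lra|].
      unfold Rdiv. rewrite Rmult_assoc, Rinv_l by lra. nra.
    + eapply Rle_trans; [apply Hbound, (dp_free _ _ _ _ HD); auto|].
      apply Rmult_le_reg_r with (INR (mult N n z i)); [lra|].
      unfold Rdiv. rewrite Rmult_assoc, Rinv_l by lra. nra.
  - eapply Rle_trans; [apply (total_share_le N HN n z i V (incident N v)); auto|].
    + intros e He Hinc. destruct (vertex_end y v e Hy He Hv Hinc) as (s & Hs & Hend & Vs).
      assert (Hr : reach (len N e) (O e) s V).
      { destruct Hv as [Hv _]. destruct Hend as [[-> <-]|[-> <-]].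
        - apply (dp_src _ _ _ _ (HO e He)); auto.
        - apply (dp_dst _ _ _ _ (HO e He)); auto. }
      destruct Hr as (lo & hi & H1 & H2 & H3 & H4).
      exists lo, hi. repeat split; try lra; apply H4; auto;
        destruct (Hnear e t He H H0) as (s' & Hs' & Hd & Hle);
        (replace s with s'; auto); apply (dist_zero_same_edge N HN e); auto;
        try (now apply valid_edge);
        (apply (dist_zero_trans N HN _ y); auto; try (now apply valid_edge));
        rewrite dist_sym; auto.
    + intros e He Hinc t Ht. apply not_true_is_false. intros Hc.
      destruct (Hnear e t He Ht Hc) as (s & Hs & Hd & _).
      rewrite (vertex_not_incident y v e s) in Hinc; auto. now apply valid_edge.
    + rewrite <- (crowd_vertex y v Hy Hv).
      pose proof (le_INR _ _ (crowd_le_mult_upd i y Hy)) as Hle. fold z in Hle.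
      apply Rmult_le_reg_r with (INR (mult N n z i)); [lra|].
      replace (V / INR (mult N n z i) * INR (crowd y) * INR (mult N n z i)) with (V * INR (crowd y))
        by (field; lra).
      nra.
Qed.

Lemma config_guarded e : (e < nE N)%nat -> guarded N e (fun a => In a (L e)).
Proof. intros He. apply dp_guarded with eta. apply (eb_all _ _ _ _ (HL e He)). lra. Qed.

Lemma owned_share i W (p : nat -> bool) : (i < n)%nat ->
  (forall e, (e < nE N)%nat -> p e = true -> exists s, 0 <= s <= len N e /\
     dist N (e, s) (x i) = 0 /\ owns (len N e) (fun a => In a (L e)) s W) ->
  (forall e a, (e < nE N)%nat -> p e = true -> 0 <= a <= len N e ->
     (exists j, (j < n)%nat /\ dist N (e, a) (x j) = 0) -> In a (L e)) ->
  W / INR (mult N n x i) * INR (length (filter p (seq 0 (nE N)))) <= total_share N n x i.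
Proof.
  intros Hi Hp Hin. apply (total_share_ge N HN n x i W p config_valid Hi).
  intros e He Hpe. destruct (Hp e He Hpe) as (s & Hs & Hd & lo & hi & H1 & H2 & H3 & H4).
  exists lo, hi. repeat split; auto; try lra.
  intros t Ht j Hj Hc.
  assert (Vt : valid_point N (e, t)) by (apply valid_edge; auto; lra).
  assert (Vs : valid_point N (e, s)) by (apply valid_edge; auto).
  destruct (closest_nearest x e t j (fun a => In a (L e)) config_valid Hj Vt) as (s' & Hs' & Hd' & Hle); auto.
  - now apply config_guarded.
  - intros a Ha Ia. destruct (config_player e a He Ia) as (k & Hk & E). exists k; split; auto.
    rewrite E. apply dist_refl; auto. now apply valid_edge.
  - pose proof (config_valid j Hj). pose proof (config_valid i Hi).
    assert (In s' (L e)) by (apply Hin; eauto).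
    assert (In s (L e)) by (apply Hin; eauto).
    assert (s' = s) as -> by (apply (H4 t Ht); auto).
    apply (dist_zero_trans N HN _ (e, s)); auto. rewrite dist_sym; auto.
Qed.

Lemma occupied_in_config e a : (e < nE N)%nat -> 0 <= a <= len N e ->
  (exists j, (j < n)%nat /\ dist N (e, a) (x j) = 0) -> In a (L e).
Proof.
  intros He Ha (j & Hj & Hd). destruct (player_config j Hj) as [Hf Hp].
  pose proof (config_valid j Hj) as Vj.
  assert (Va : valid_point N (e, a)) by (now apply valid_edge).
  destruct (dist_zero_cases N HN _ _ Va Vj Hd) as [E|(v & E1 & E2)].
  - rewrite <- E in Hp. auto.
  - destruct (leafb N v) eqn:Hleaf.
    + exfalso. unfold end_cost in E2. destruct E2 as [[-> E2]|[-> E2]].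
      * pose proof (eb_src _ _ _ _ (HL _ Hf)) as H. rewrite Hleaf in H. rewrite <- E2 in Hp. auto.
      * pose proof (eb_dst _ _ _ _ (HL _ Hf)) as H. rewrite Hleaf in H.
        replace (snd (x j)) with (len N (fst (x j))) in Hp by lra. auto.
    + assert (Hm : forall q, multiplicity q (L e) = 1%nat -> In q (L e)).
      { intros q Hq. apply (count_occ_In Req_EM_T). unfold multiplicity in Hq. lia. }
      unfold end_cost in E1; simpl in E1. destruct E1 as [[-> <-]|[-> E1]]; apply Hm.
      * pose proof (eb_src _ _ _ _ (HL _ He)) as H. rewrite Hleaf in H. apply H.
      * pose proof (eb_dst _ _ _ _ (HL _ He)) as H. rewrite Hleaf in H.
        replace a with (len N e) by lra. apply H.
Qed.

Lemma config_off_vertex_inner i : (i < n)%nat -> off_vertex (x i) ->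
  0 < snd (x i) < len N (fst (x i)).
Proof.
  intros Hi [H1 H2]. destruct (player_config i Hi) as [Hf Hp].
  pose proof (eb_src _ _ _ _ (HL _ Hf)) as Hsrc. pose proof (eb_dst _ _ _ _ (HL _ Hf)) as Hdst.
  pose proof (eb_range _ _ _ _ (HL _ Hf) _ Hp) as [[R1|R1] [R2|R2]]; split; auto; exfalso.
  - rewrite (H2 R2), <- R2 in Hdst. auto.
  - symmetry in R1. rewrite (H1 R1), <- R1 in Hsrc. auto.
  - symmetry in R1. rewrite (H1 R1), <- R1 in Hsrc. auto.
  - symmetry in R1. rewrite (H1 R1), <- R1 in Hsrc. auto.
Qed.

Lemma off_vertex_share i W : (i < n)%nat -> off_vertex (x i) ->
  owns (len N (fst (x i))) (fun a => In a (L (fst (x i)))) (snd (x i)) W ->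
  W / INR (mult N n x i) <= total_share N n x i.
Proof.
  intros Hi Hoff Hown. destruct (player_config i Hi) as [Hf Hp].
  pose proof (config_valid i Hi) as Vi.
  rewrite <- (Rmult_1_r (W / _)). change 1 with (INR 1).
  rewrite <- (filter_eqb_seq (nE N) (fst (x i)) Hf).
  apply owned_share; auto.
  - intros e He E. apply Nat.eqb_eq in E. subst e. exists (snd (x i)).
    split; [apply Vi|]. split; auto. rewrite <- surjective_pairing. now apply dist_refl.
  - intros; apply occupied_in_config; auto.
Qed.

Theorem balanced_equilibrium :
  (forall v e, (e < nE N)%nat -> incident N v e = true -> leafb N v = false -> (2 <= degree N v)%nat) ->
  has_pure_NE N n.
Proof.
  intros Hdeg. exists x. split; [exact config_valid|]. intros i Hi.
  exists (total_share N n x i). split; [apply payoff_total_share; auto; apply config_valid|].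
  intros y Hy. exists (total_share N n (upd x i y) i).
  split; [apply payoff_total_share; auto; apply valid_upd; auto; apply config_valid|].
  destruct (player_config i Hi) as [Hf Hp]. pose proof (config_valid i Hi) as Vi.
  assert (Hcrowd : (2 <= mult N n x i)%nat -> eta <= total_share N n x i ->
    total_share N n (upd x i y) i <= total_share N n x i).
  { intros Hm Hge. apply Rle_trans with eta; auto.
    destruct (partner i Hi Hm) as (j & Hj & Hne & Hd).
    apply (deviation_bound i eta (fun e a => In a (L e))); auto.
    - intros e He. apply (eb_all _ _ _ _ (HL e He)). lra.
    - intros e a He Ia. destruct (config_player e a He Ia) as (k & Hk & E).
      assert (Va : valid_point N (e, a)) by (rewrite <- E; now apply config_valid).
      destruct (Nat.eq_dec k i) as [->|Hki].
      + exists j. rewrite <- E. repeat split; auto. rewrite dist_sym; auto. now apply config_valid.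
      + exists k. rewrite E. repeat split; auto. now apply dist_refl. }
  destruct (vertex_or_off (x i)) as [Hoff|(v & Hv)].
  - pose proof (mult_crowd i) as Hmc. rewrite (crowd_off_vertex (x i) Vi Hoff) in Hmc.
    pose proof (config_off_vertex_inner i Hi Hoff) as Hin.
    destruct (eb_inner _ _ _ _ (HL _ Hf) _ Hp Hin) as [[Hc Hown]|[Hc (V & HV & Hown & HD)]].
    + rewrite Hc in Hmc. apply Hcrowd; [lia|].
      pose proof (off_vertex_share i _ Hi Hoff Hown) as H. rewrite Hmc in H. simpl in H. lra.
    + rewrite Hc in Hmc. apply Rle_trans with V.
      * apply (deviation_bound i V (fun e a => In a (L e) /\ (e, a) <> x i)); auto; try lra.
        -- intros e He. destruct (Nat.eq_dec e (fst (x i))) as [->|Hne].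
           ++ eapply deviation_proof_ext; [|exact HD]. intros a.
              split; intros [H1 H2]; split; auto.
              ** intros E; apply H2; now rewrite <- E.
              ** intros ->. apply H2. now rewrite <- surjective_pairing.
           ++ eapply deviation_proof_ext; [|exact (eb_all _ _ _ _ (HL _ He) V HV)].
              intros a. split; [|easy]. intros Ia. split; auto. intros E. apply Hne. now rewrite <- E.
        -- intros e a He [Ia _]; auto.
        -- intros e a He [Ia Ha]. destruct (config_player e a He Ia) as (k & Hk & E).
           exists k. rewrite E. repeat split; auto.
           ++ intros ->. auto.
           ++ apply dist_refl; auto. rewrite <- E; now apply config_valid.
      * pose proof (off_vertex_share i _ Hi Hoff Hown) as H. rewrite Hmc in H. simpl in H. lra.
  - pose proof (mult_crowd i) as Hmc. rewrite (crowd_vertex (x i) v Vi Hv) in Hmc.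
    change (length (filter (incident N v) (seq 0 (nE N)))) with (degree N v) in Hmc.
    assert (Hd2 : (2 <= degree N v)%nat).
    { apply Hdeg with (fst (x i)); auto; [|apply Hv]. apply (end_cost_incident N _ (snd (x i)) v 0).
      rewrite <- surjective_pairing. apply Hv. }
    apply Hcrowd; [lia|].
    apply le_INR in Hd2; simpl in Hd2.
    apply Rle_trans with (eta / INR (mult N n x i) * INR (degree N v)).
    + rewrite Hmc. right. field. lra.
    + apply (owned_share i eta (incident N v)); auto.
      * intros e He Hinc. destruct (vertex_end (x i) v e Vi He Hv Hinc) as (s & Hs & Hend & Vs).
        exists s. split; [apply Vs|]. split; auto.
        destruct Hv as [Hv _]. destruct Hend as [[-> <-]|[-> <-]].
        -- pose proof (eb_src _ _ _ _ (HL e He)) as H. rewrite Hv in H. apply H.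
        -- pose proof (eb_dst _ _ _ _ (HL e He)) as H. rewrite Hv in H. apply H.
      * intros; apply occupied_in_config; auto.
Qed.

End Equilibrium.

(** * Chains of locations on an edge *)

Ltac Rabs_cases := unfold Rabs in *; repeat match goal with
  | H : context [Rcase_abs ?a] |- _ => destruct (Rcase_abs a)
  | |- context [Rcase_abs ?a] => destruct (Rcase_abs a)
  end; try lra.

Section Chain.
Context (Q : nat -> R) (M : nat) (V l : R) (la lb : bool).
Context (Hmono : forall i j, (i <= j)%nat -> (j <= M)%nat -> Q i <= Q j).
Context (Hgap : forall i, (i < M)%nat -> Q (S i) <= Q i + 2 * V).
Context (HAB : Q 0%nat < Q M).
Context (HA : if la then 0 < Q 0%nat <= V else Q 0%nat = 0).
Context (HB : if lb then 0 < l - Q M <= V else Q M = l).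

Let O a := exists i, (i <= M)%nat /\ a = Q i.

Lemma chain_bracket_right s : Q 0%nat <= s < Q M -> exists i, (i < M)%nat /\ Q i <= s < Q (S i).
Proof.
  intros [H0 HM]. assert (H : forall m, s < Q m -> exists i, (i < m)%nat /\ Q i <= s < Q (S i)).
  { induction m as [|m IH]; intros Hm; [lra|].
    destruct (Rle_lt_dec (Q m) s) as [H|H]; [exists m; split; auto|].
    destruct (IH H) as (i & Hi & Hi'). exists i; split; auto; lia. }
  auto.
Qed.

Lemma chain_bracket_left s : Q 0%nat < s <= Q M -> exists i, (i < M)%nat /\ Q i < s <= Q (S i).
Proof.
  intros [H0 HM]. assert (H : forall m, s <= Q m -> exists i, (i < m)%nat /\ Q i < s <= Q (S i)).
  { induction m as [|m IH]; intros Hm; [lra|].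
    destruct (Rlt_le_dec (Q m) s) as [H|H]; [exists m; split; auto|].
    destruct (IH H) as (i & Hi & Hi'). exists i; split; auto; lia. }
  auto.
Qed.

Lemma chain_V_pos : 0 < V.
Proof.
  apply Rnot_le_lt. intros HV.
  assert (H : forall m, (m <= M)%nat -> Q m <= Q 0%nat).
  { induction m as [|m IH]; intros Hm; [lra|].
    pose proof (IH ltac:(lia)). pose proof (Hgap m ltac:(lia)). lra. }
  specialize (H M (le_n M)). lra.
Qed.

Lemma chain_range i : (i <= M)%nat -> 0 <= Q i <= l.
Proof.
  intros Hi. pose proof (Hmono 0 i ltac:(lia) Hi). pose proof (Hmono i M Hi (le_n M)).
  destruct la, lb; lra.
Qed.

Lemma chain_right_bound s : O s -> exists hi, s <= hi <= l /\ hi - s <= V /\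
  forall t, t <= l -> (forall a, 0 <= a <= l -> O a -> Rabs (t - s) <= Rabs (t - a)) -> t <= hi.
Proof.
  pose proof chain_V_pos as HV.
  intros (j & Hj & ->). pose proof (chain_range j Hj). pose proof (Hmono j M Hj (le_n M)) as [H1|H1].
  - destruct (chain_bracket_right (Q j)) as (i & Hi & H2).
    { split; auto. apply Hmono; lia. }
    pose proof (Hgap i Hi). pose proof (chain_range (S i) Hi).
    exists ((Q j + Q (S i)) / 2). split; [lra|]. split; [lra|]. intros t Ht Hn.
    assert (HO : O (Q (S i))) by (exists (S i); auto).
    specialize (Hn (Q (S i)) ltac:(lra) HO). Rabs_cases.
  - exists l. split; [lra|]. split; [destruct lb; lra|]. auto.
Qed.

Lemma chain_left_bound s : O s -> exists lo, 0 <= lo <= s /\ s - lo <= V /\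
  forall t, 0 <= t -> (forall a, 0 <= a <= l -> O a -> Rabs (t - s) <= Rabs (t - a)) -> lo <= t.
Proof.
  pose proof chain_V_pos as HV.
  intros (j & Hj & ->). pose proof (chain_range j Hj). pose proof (Hmono 0 j ltac:(lia) Hj) as [H1|H1].
  - destruct (chain_bracket_left (Q j)) as (i & Hi & H2).
    { split; auto. }
    pose proof (Hgap i Hi). pose proof (chain_range i ltac:(lia)).
    exists ((Q j + Q i) / 2). split; [lra|]. split; [lra|]. intros t Ht Hn.
    assert (HO : O (Q i)) by (exists i; split; auto; lia).
    specialize (Hn (Q i) ltac:(lra) HO). Rabs_cases.
  - exists 0. split; [lra|]. split; [destruct la; lra|]. auto.
Qed.

Lemma chain_reach_occupied s : O s -> reach l O s (2 * V).
Proof.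
  intros Hs. destruct (chain_right_bound s Hs) as (hi & H1 & H2 & H3).
  destruct (chain_left_bound s Hs) as (lo & H4 & H5 & H6).
  exists lo, hi. split; [lra|]. split; [lra|]. split; [lra|].
  intros t Ht Hc. split; [apply H6|apply H3]; auto; lra.
Qed.

Lemma chain_reach_src : la = false -> reach l O 0 V.
Proof.
  intros E. assert (Hs : O 0) by (exists 0%nat; split; [lia|rewrite E in HA; auto]).
  destruct (chain_right_bound 0 Hs) as (hi & H1 & H2 & H3).
  exists 0, hi. split; [lra|]. split; [lra|]. split; [lra|].
  intros t Ht Hc. split; [lra|apply H3; auto; lra].
Qed.

Lemma chain_reach_dst : lb = false -> reach l O l V.
Proof.
  intros E. assert (Hs : O l) by (exists M; split; [lia|rewrite E in HB; auto]).
  destruct (chain_left_bound l Hs) as (lo & H1 & H2 & H3).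
  exists lo, l. split; [lra|]. split; [lra|]. split; [lra|].
  intros t Ht Hc. split; [apply H3; auto; lra|lra].
Qed.

Lemma chain_reach_free s : 0 <= s <= l -> ~ O s -> reach l O s V.
Proof.
  intros Hs Hn. pose proof (chain_range 0 ltac:(lia)). pose proof (chain_range M (le_n M)).
  destruct (Rlt_le_dec s (Q 0%nat)) as [H1|H1]; [|destruct (Rlt_le_dec (Q M) s) as [H2|H2]].
  - exists 0, (Q 0%nat). split; [lra|]. split; [lra|]. split; [destruct la; lra|]. intros t Ht Hc.
    assert (HO : O (Q 0%nat)) by (exists 0%nat; split; auto; lia).
    specialize (Hc (Q 0%nat) ltac:(lra) HO). Rabs_cases.
  - exists (Q M), l. split; [lra|]. split; [lra|]. split; [destruct lb; lra|]. intros t Ht Hc.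
    assert (HO : O (Q M)) by (exists M; split; auto; lia).
    specialize (Hc (Q M) ltac:(lra) HO). Rabs_cases.
  - assert (s <> Q M) by (intros ->; apply Hn; exists M; auto).
    destruct (chain_bracket_right s) as (i & Hi & H4); [lra|].
    assert (s <> Q i) by (intros ->; apply Hn; exists i; split; auto; lia).
    pose proof (Hgap i Hi). pose proof (chain_range i ltac:(lia)). pose proof (chain_range (S i) Hi).
    assert (O1 : O (Q i)) by (exists i; split; auto; lia).
    assert (O2 : O (Q (S i))) by (exists (S i); split; auto; lia).
    exists ((Q i + s) / 2), ((s + Q (S i)) / 2). split; [lra|]. split; [lra|]. split; [lra|].
    intros t Ht Hc. pose proof (Hc (Q i) ltac:(lra) O1). pose proof (Hc (Q (S i)) ltac:(lra) O2).
    clear Hc. split; Rabs_cases.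
Qed.

End Chain.

Lemma chain_deviation_proof N e (Q : nat -> R) M V :
  (forall i j, (i <= j)%nat -> (j <= M)%nat -> Q i <= Q j) ->
  (forall i, (i < M)%nat -> Q (S i) <= Q i + 2 * V) -> Q 0%nat < Q M ->
  (if leafb N (src N e) then 0 < Q 0%nat <= V else Q 0%nat = 0) ->
  (if leafb N (dst N e) then 0 < len N e - Q M <= V else Q M = len N e) ->
  deviation_proof N e V (fun a => exists i, (i <= M)%nat /\ a = Q i).
Proof.
  intros Hmono Hgap HAB HA HB.
  pose proof (chain_range Q M V (len N e) _ _ Hmono HA HB) as Hr.
  constructor.
  - split.
    + destruct (leafb N (src N e)).
      * exists (Q 0%nat). split; [exists 0%nat; split; auto; lia|].
        pose proof (Hr 0%nat ltac:(lia)). pose proof (Hr M ltac:(lia)). lra.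
      * exists 0%nat; split; auto; lia.
    + destruct (leafb N (dst N e)).
      * exists (Q M). split; [exists M; split; auto; lia|].
        pose proof (Hr 0%nat ltac:(lia)). pose proof (Hr M ltac:(lia)). lra.
      * exists M; split; auto; lia.
  - intros E. eapply chain_reach_src; eauto.
  - intros E. eapply chain_reach_dst; eauto.
  - intros s Hs Hn. eapply chain_reach_free; eauto.
  - intros s _ Hs. eapply chain_reach_occupied; eauto.
Qed.

Lemma owns_between l (O : R -> Prop) a s b : 0 <= a -> a < s < b -> b <= l ->
  (forall p, O p -> p <= a \/ p = s \/ b <= p) -> owns l O s ((b - a) / 2).
Proof.
  intros Ha Hs Hb HO. exists ((a + s) / 2), ((s + b) / 2). split; [lra|]. split; [lra|]. split; [lra|].
  intros t Ht p Hp Op Hle. destruct (HO p Op) as [H|[H|H]]; auto; exfalso; Rabs_cases.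
Qed.

Lemma owns_first l (O : R -> Prop) s b : 0 <= s -> s < b <= l ->
  (forall p, O p -> p = s \/ b <= p) -> owns l O s (s + (b - s) / 2).
Proof.
  intros Ha Hb HO. exists 0, ((s + b) / 2). split; [lra|]. split; [lra|]. split; [lra|].
  intros t Ht p Hp Op Hle. destruct (HO p Op) as [H|H]; auto; exfalso; Rabs_cases.
Qed.

Lemma owns_last l (O : R -> Prop) a s : 0 <= a < s -> s <= l ->
  (forall p, O p -> p <= a \/ p = s) -> owns l O s (l - s + (s - a) / 2).
Proof.
  intros Ha Hb HO. exists ((a + s) / 2), l. split; [lra|]. split; [lra|]. split; [lra|].
  intros t Ht p Hp Op Hle. destruct (HO p Op) as [H|H]; auto; exfalso; Rabs_cases.
Qed.

(** * The configuration on an edge *)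

Section EdgeConfiguration.
Context (N : network) (e : nat) (eta : R) (k c : nat).

Definition setback (v : nat) : R := if leafb N v then eta else 0.

(* Slots [0..k+1] are [2 eta] apart, and so are [k+2] and [k+3]; the gap between [k+1] and [k+2] is
   what remains. When that gap is [0] these two slots form a single location with two players. *)
Definition slot (i : nat) : R :=
  if Nat.leb i (k + 1) then setback (src N e) + 2 * eta * INR i
  else len N e - setback (dst N e) - (if Nat.eqb i (k + 2) then 2 * eta else 0).

Definition slot_indices : list nat :=
  seq 0 (k + 4) ++ seq 1 c ++
  (if leafb N (src N e) then 0%nat :: nil else nil) ++
  (if leafb N (dst N e) then (k + 3)%nat :: nil else nil).

Definition edge_config : list R := map slot slot_indices.

Context (Heta : 0 < eta) (Hck : (c <= k)%nat).
Context (Hlo : slot (k + 1) <= slot (k + 2)) (Hhi : slot (k + 2) <= slot (k + 1) + 2 * eta).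

Lemma slot_step_eq i : (i <= k \/ i = k + 2)%nat -> slot (S i) = slot i + 2 * eta.
Proof.
  unfold slot. intros [H| ->].
  - rewrite !(proj2 (Nat.leb_le _ _)) by lia. rewrite S_INR. ring.
  - rewrite !(proj2 (Nat.leb_gt _ _)) by lia.
    rewrite Nat.eqb_refl, (proj2 (Nat.eqb_neq _ _)) by lia. ring.
Qed.

Lemma slot_step i : (i < k + 3)%nat -> slot i <= slot (S i) <= slot i + 2 * eta.
Proof.
  intros Hi. destruct (Nat.eq_dec i (k + 1)) as [->|Hne].
  - replace (S (k + 1)) with (k + 2)%nat by lia. lra.
  - rewrite slot_step_eq by lia. lra.
Qed.

Lemma slot_mono i j : (i <= j)%nat -> (j <= k + 3)%nat -> slot i <= slot j.
Proof.
  induction 1 as [|j Hij IH]; intros Hj; [lra|].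
  pose proof (slot_step j ltac:(lia)). specialize (IH ltac:(lia)). lra.
Qed.

Lemma slot_strict i j : (i < j <= k + 3)%nat -> ~ (i = k + 1 /\ j = k + 2)%nat -> slot i < slot j.
Proof.
  intros Hij Hne. destruct (Nat.eq_dec i (k + 1)) as [->|Hi].
  - assert (j = S (k + 2)) as -> by lia. rewrite slot_step_eq by lia. lra.
  - pose proof (slot_mono (S i) j ltac:(lia) ltac:(lia)) as H.
    rewrite slot_step_eq in H by lia. lra.
Qed.

Lemma slot_first : slot 0 = setback (src N e).
Proof. unfold slot. simpl. ring. Qed.

Lemma slot_last : slot (k + 3) = len N e - setback (dst N e).
Proof.
  unfold slot. rewrite (proj2 (Nat.leb_gt _ _)) by lia.
  rewrite (proj2 (Nat.eqb_neq _ _)) by lia. ring.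
Qed.

Lemma in_edge_config a : In a edge_config <-> exists i, (i <= k + 3)%nat /\ a = slot i.
Proof.
  unfold edge_config, slot_indices. rewrite in_map_iff. split.
  - intros (i & <- & Hi). exists i; split; auto. rewrite !in_app_iff, !in_seq in Hi.
    destruct Hi as [Hi|[Hi|[Hi|Hi]]]; try lia.
    + destruct (leafb N (src N e)); destruct Hi as [<-|[]] || destruct Hi; lia.
    + destruct (leafb N (dst N e)); destruct Hi as [<-|[]] || destruct Hi; lia.
  - intros (i & Hi & ->). exists i; split; auto. apply in_or_app; left. apply in_seq; lia.
Qed.

Definition slot_count (p : R) (l : list nat) : nat := length (filter (fun i => Reqb (slot i) p) l).

Lemma multiplicity_slots p :
  multiplicity p edge_config = (slot_count p (seq 0 (k + 4)) + slot_count p (seq 1 c) +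
    (if leafb N (src N e) then slot_count p (0%nat :: nil) else 0) +
    (if leafb N (dst N e) then slot_count p ((k + 3)%nat :: nil) else 0))%nat.
Proof.
  assert (H : forall l, multiplicity p (map slot l) = slot_count p l).
  { unfold multiplicity, slot_count, Reqb. induction l as [|i l IH]; simpl; auto.
    destruct (Req_EM_T (slot i) p); simpl; auto. }
  unfold edge_config. rewrite H. unfold slot_indices, slot_count.
  rewrite !filter_app, !length_app.
  destruct (leafb N (src N e)), (leafb N (dst N e)); simpl; lia.
Qed.

Lemma slot_count_one p a m i : (a <= i < a + m)%nat -> slot i = p ->
  (forall j, (a <= j < a + m)%nat -> slot j = p -> j = i) -> slot_count p (seq a m) = 1%nat.
Proof.
  intros Hi <- Hu. apply filter_seq_unique with i; auto; [now apply Reqb_true|].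
  intros j Hj H. apply Hu; auto. now apply Reqb_true.
Qed.

Lemma slot_count_none p l : (forall j, In j l -> slot j <> p) -> slot_count p l = 0%nat.
Proof.
  intros H. apply filter_none_length. intros j Hj. apply not_true_is_false. rewrite Reqb_true. auto.
Qed.

Lemma slot_ends : (if leafb N (src N e) then slot 0 = eta else slot 0 = 0) /\
  (if leafb N (dst N e) then slot (k + 3) = len N e - eta else slot (k + 3) = len N e).
Proof.
  rewrite slot_first, slot_last. unfold setback.
  destruct (leafb N (src N e)), (leafb N (dst N e)); lra.
Qed.

Lemma slot_range i : (i <= k + 3)%nat -> 0 <= slot i <= len N e.
Proof.
  intros Hi. pose proof slot_ends as [H1 H2]. pose proof (slot_mono 0 i ltac:(lia) Hi).
  pose proof (slot_mono i (k + 3) Hi ltac:(lia)).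
  destruct (leafb N (src N e)), (leafb N (dst N e)); lra.
Qed.

Lemma edge_config_deviation V : eta <= V -> deviation_proof N e V (fun a => In a edge_config).
Proof.
  intros HV. eapply deviation_proof_ext; [intros a; symmetry; apply in_edge_config|].
  pose proof slot_ends as [H1 H2].
  apply chain_deviation_proof.
  - exact slot_mono.
  - intros i Hi. pose proof (slot_step i Hi). lra.
  - apply slot_strict; lia.
  - destruct (leafb N (src N e)); lra.
  - destruct (leafb N (dst N e)); lra.
Qed.

Lemma edge_config_deviation_without m : (1 <= m <= k + 2)%nat ->
  slot (m - 1) < slot m < slot (m + 1) ->
  deviation_proof N e ((slot (m + 1) - slot (m - 1)) / 2) (fun a => In a edge_config /\ a <> slot m).
Proof.
  intros Hm Hs. set (V := (slot (m + 1) - slot (m - 1)) / 2).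
  assert (HV : eta <= V).
  { unfold V. destruct (Nat.eq_dec m (k + 2)) as [->|Hne].
    - replace (k + 2 + 1)%nat with (S (k + 2)) in * by lia. rewrite slot_step_eq in * by lia. lra.
    - pose proof (slot_step_eq (m - 1) ltac:(lia)) as E. replace (S (m - 1)) with m in E by lia. lra. }
  pose (Q := fun i => if Nat.ltb i m then slot i else slot (S i)).
  assert (Q1 : forall i, (i < m)%nat -> Q i = slot i)
    by (intros i Hi; unfold Q; rewrite (proj2 (Nat.ltb_lt i m) Hi); auto).
  assert (Q2 : forall i, (m <= i)%nat -> Q i = slot (S i))
    by (intros i Hi; unfold Q; rewrite (proj2 (Nat.ltb_ge i m) Hi); auto).
  pose proof slot_ends as [H1 H2].
  assert (HQM : Q (k + 2)%nat = slot (k + 3)) by (rewrite Q2 by lia; f_equal; lia).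
  eapply deviation_proof_ext; [|apply (chain_deviation_proof N e Q (k + 2) V)].
  - intros a. rewrite in_edge_config. split.
    + intros (i & Hi & ->). destruct (lt_dec i m) as [H|H].
      * rewrite Q1 by lia. split; [exists i; split; auto; lia|].
        pose proof (slot_mono i (m - 1) ltac:(lia) ltac:(lia)). lra.
      * rewrite Q2 by lia. split; [exists (S i); split; auto; lia|].
        pose proof (slot_mono (m + 1) (S i) ltac:(lia) ltac:(lia)). lra.
    + intros [(i & Hi & ->) Hne]. destruct (lt_eq_lt_dec i m) as [[H| ->]|H]; [|easy|].
      * exists i. rewrite Q1 by lia. split; auto; lia.
      * exists (i - 1)%nat. rewrite Q2 by lia. split; [lia|]. f_equal; lia.
  - intros i j Hij Hj. destruct (lt_dec i m), (lt_dec j m).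
    + rewrite !Q1 by lia. apply slot_mono; lia.
    + rewrite Q1, Q2 by lia. apply slot_mono; lia.
    + lia.
    + rewrite !Q2 by lia. apply slot_mono; lia.
  - intros i Hi. destruct (lt_eq_lt_dec (S i) m) as [[H|H]|H].
    + rewrite !Q1 by lia. pose proof (slot_step i ltac:(lia)). lra.
    + rewrite (Q1 i), (Q2 (S i)) by lia. unfold V. replace (m - 1)%nat with i by lia.
      replace (m + 1)%nat with (S (S i)) by lia. lra.
    + rewrite !Q2 by lia. pose proof (slot_step (S i) ltac:(lia)). lra.
  - rewrite Q1, HQM by lia. apply slot_strict; lia.
  - rewrite Q1 by lia. destruct (leafb N (src N e)); lra.
  - rewrite HQM. destruct (leafb N (dst N e)); lra.
Qed.

Lemma owns_slot i m j : (i <= k + 3)%nat -> (j <= k + 3)%nat -> slot i < slot m < slot j ->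
  (forall h, (i < h < j)%nat -> slot h = slot m) ->
  owns (len N e) (fun a => In a edge_config) (slot m) ((slot j - slot i) / 2).
Proof.
  intros Hi Hj Hs Hh. pose proof (slot_range i Hi). pose proof (slot_range j Hj).
  apply owns_between; try lra.
  intros p Hp. apply in_edge_config in Hp as (h & Hh' & ->).
  destruct (le_lt_dec h i) as [H1|H1]; [left; now apply slot_mono|].
  destruct (le_lt_dec j h) as [H2|H2]; [right; right; now apply slot_mono|].
  right; left; auto.
Qed.

Lemma multiplicity_inner p : 0 < p < len N e ->
  (leafb N (src N e) = true -> p <> slot 0) -> (leafb N (dst N e) = true -> p <> slot (k + 3)) ->
  multiplicity p edge_config = (slot_count p (seq 0 (k + 4)) + slot_count p (seq 1 c))%nat.
Proof.
  intros Hp H1 H2. rewrite multiplicity_slots.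
  destruct (leafb N (src N e)); destruct (leafb N (dst N e));
    rewrite ?(slot_count_none p (0%nat :: nil)), ?(slot_count_none p ((k + 3)%nat :: nil));
    try lia; intros j [<-|[]] E; symmetry in E;
    first [exact (H1 eq_refl E)|exact (H2 eq_refl E)].
Qed.

Lemma edge_config_single m : (1 <= m <= k + 2)%nat -> slot (m - 1) < slot m < slot (m + 1) ->
  (c < m)%nat ->
  multiplicity (slot m) edge_config = 1%nat /\ exists V, eta <= V /\
    owns (len N e) (fun a => In a edge_config) (slot m) V /\
    deviation_proof N e V (fun a => In a edge_config /\ a <> slot m).
Proof.
  intros Hm Hs Hc.
  assert (Hu : forall j, (j <= k + 3)%nat -> slot j = slot m -> j = m).
  { intros j Hj E. destruct (lt_eq_lt_dec j m) as [[H|H]|H]; auto; exfalso.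
    - pose proof (slot_mono j (m - 1) ltac:(lia) ltac:(lia)). lra.
    - pose proof (slot_mono (m + 1) j ltac:(lia) ltac:(lia)). lra. }
  pose proof (slot_range (m - 1) ltac:(lia)). pose proof (slot_range (m + 1) ltac:(lia)).
  split.
  - rewrite multiplicity_inner; [|lra| |].
    + rewrite (slot_count_one _ 0 (k + 4) m), (slot_count_none _ (seq 1 c)); auto; try lia.
      * intros j Hj E. apply in_seq in Hj. apply Hu in E; lia.
      * intros j Hj E. apply Hu; auto; lia.
    + intros _ E. symmetry in E. apply Hu in E; lia.
    + intros _ E. symmetry in E. apply Hu in E; lia.
  - exists ((slot (m + 1) - slot (m - 1)) / 2). split; [|split].
    + destruct (Nat.eq_dec m (k + 2)) as [->|Hne].
      * replace (k + 2 + 1)%nat with (S (k + 2)) in * by lia. rewrite slot_step_eq in * by lia. lra.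
      * pose proof (slot_step_eq (m - 1) ltac:(lia)) as E. replace (S (m - 1)) with m in E by lia. lra.
    + apply owns_slot; auto; try lia. intros h Hh. f_equal; lia.
    + now apply edge_config_deviation_without.
Qed.

Lemma edge_config_balanced : edge_balanced N eta edge_config e.
Proof.
  pose proof slot_ends as [HA HB].
  pose proof (slot_step_eq 0 ltac:(lia)) as Hfirst.
  pose proof (slot_step_eq (k + 2) ltac:(lia)) as Hlast.
  replace (S (k + 2)) with (k + 3)%nat in Hlast by lia.
  assert (Hup : forall i, (1 <= i <= k + 3)%nat -> slot 1 <= slot i) by (intros; apply slot_mono; lia).
  assert (Hdn : forall i, (i <= k + 2)%nat -> slot i <= slot (k + 2)) by (intros; apply slot_mono; lia).
  assert (HA0 : 0 <= slot 0) by apply (slot_range 0 ltac:(lia)).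
  assert (HB0 : slot (k + 3) <= len N e) by (apply slot_range; lia).
  assert (Hin1 : forall p, In p edge_config -> p = slot 0 \/ slot 1 <= p).
  { intros p Hp. apply in_edge_config in Hp as ([|i] & Hi & ->); auto. right; apply Hup; lia. }
  assert (Hin2 : forall p, In p edge_config -> p <= slot (k + 2) \/ p = slot (k + 3)).
  { intros p Hp. apply in_edge_config in Hp as (i & Hi & ->).
    destruct (Nat.eq_dec i (k + 3)) as [->|]; auto. left; apply Hdn; lia. }
  assert (Hmult0 : (slot_count (slot 0) (seq 0 (k + 4)) = 1 /\ slot_count (slot 0) (seq 1 c) = 0 /\
    slot_count (slot 0) (0 :: nil) = 1 /\ slot_count (slot 0) ((k + 3) :: nil) = 0)%nat).
  { assert (Hne : forall j, (1 <= j <= k + 3)%nat -> slot j <> slot 0)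
      by (intros j Hj; specialize (Hup j Hj); lra).
    split; [|split; [|split]].
    - apply slot_count_one with 0%nat; auto; [lia|]. intros [|j] Hj E; auto. apply Hne in E; [easy|lia].
    - apply slot_count_none. intros j Hj. apply in_seq in Hj. apply Hne; lia.
    - apply (slot_count_one (slot 0) 0 1 0); auto. intros; lia.
    - apply slot_count_none. intros j [<-|[]]. apply Hne; lia. }
  assert (Hmult1 : (slot_count (slot (k + 3)) (seq 0 (k + 4)) = 1 /\ slot_count (slot (k + 3)) (seq 1 c) = 0 /\
    slot_count (slot (k + 3)) (0 :: nil) = 0 /\ slot_count (slot (k + 3)) ((k + 3) :: nil) = 1)%nat).
  { assert (Hne : forall j, (j <= k + 2)%nat -> slot j <> slot (k + 3))
      by (intros j Hj; specialize (Hdn j Hj); lra).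
    split; [|split; [|split]].
    - apply slot_count_one with (k + 3)%nat; auto; [lia|]. intros j Hj E.
      destruct (Nat.eq_dec j (k + 3)) as [|Hj']; auto. apply Hne in E; [easy|lia].
    - apply slot_count_none. intros j Hj. apply in_seq in Hj. apply Hne; lia.
    - apply slot_count_none. intros j [<-|[]]. apply Hne; lia.
    - apply (slot_count_one (slot (k + 3)) (k + 3) 1 (k + 3)); auto; intros; lia. }
  pose proof (slot_range 1 ltac:(lia)) as Hr1. pose proof (slot_range (k + 2) ltac:(lia)) as Hr2.
  constructor.
  - intros p Hp. apply in_edge_config in Hp as (i & Hi & ->). now apply slot_range.
  - destruct (leafb N (src N e)) eqn:Hla.
    + intros H. apply Hin1 in H as [H|H]; lra.
    + rewrite <- HA. split; [rewrite multiplicity_slots, Hla; destruct (leafb N (dst N e)); lia|].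
      replace eta with (slot 0 + (slot 1 - slot 0) / 2) by lra. apply owns_first; auto; lra.
  - destruct (leafb N (dst N e)) eqn:Hlb.
    + intros H. apply Hin2 in H as [H|H]; lra.
    + rewrite <- HB. split; [rewrite multiplicity_slots, Hlb; destruct (leafb N (src N e)); lia|].
      replace eta with (slot (k + 3) - slot (k + 3) + (slot (k + 3) - slot (k + 2)) / 2) by lra.
      apply owns_last; auto; lra.
  - intros p Hp Hpl. apply in_edge_config in Hp as (m & Hm & ->).
    destruct (Nat.eq_dec m 0) as [->|Hm0].
    { left. destruct (leafb N (src N e)) eqn:Hla; [|lra]. split.
      - rewrite multiplicity_slots, Hla. destruct (leafb N (dst N e)); lia.
      - replace (2 * eta) with (slot 0 + (slot 1 - slot 0) / 2) by lra. apply owns_first; auto; lra. }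
    destruct (Nat.eq_dec m (k + 3)) as [->|Hm3].
    { left. destruct (leafb N (dst N e)) eqn:Hlb; [|lra]. split.
      - rewrite multiplicity_slots, Hlb. destruct (leafb N (src N e)); lia.
      - replace (2 * eta) with (len N e - slot (k + 3) + (slot (k + 3) - slot (k + 2)) / 2) by lra.
        apply owns_last; auto; lra. }
    destruct (le_lt_dec m c) as [Hmc|Hmc].
    { left.
      pose proof (slot_strict (m - 1) m ltac:(lia) ltac:(lia)).
      pose proof (slot_strict m (m + 1) ltac:(lia) ltac:(lia)).
      assert (Hu : forall j, (j <= k + 3)%nat -> slot j = slot m -> j = m).
      { intros j Hj E. destruct (lt_eq_lt_dec j m) as [[H'|H']|H']; auto; exfalso.
        - pose proof (slot_mono j (m - 1) ltac:(lia) ltac:(lia)). lra.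
        - pose proof (slot_mono (m + 1) j ltac:(lia) ltac:(lia)). lra. }
      split.
      - rewrite multiplicity_inner; auto.
        + rewrite (slot_count_one _ 0 (k + 4) m), (slot_count_one _ 1 c m); auto; try lia;
            intros j Hj E; apply Hu; auto; lia.
        + intros _ E. symmetry in E. apply Hu in E; lia.
        + intros _ E. symmetry in E. apply Hu in E; lia.
      - pose proof (slot_step_eq (m - 1) ltac:(lia)) as E1. replace (S (m - 1)) with m in E1 by lia.
        pose proof (slot_step_eq m ltac:(lia)) as E2. replace (S m) with (m + 1)%nat in E2 by lia.
        replace (2 * eta) with ((slot (m + 1) - slot (m - 1)) / 2) by lra.
        apply owns_slot; auto; try lia. intros h Hh. f_equal; lia. }
    destruct (le_lt_dec m k) as [Hmk|Hmk].
    { right. apply edge_config_single; auto; [lia|]. split; apply slot_strict; lia. }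
    destruct (Rle_lt_or_eq_dec _ _ Hlo) as [Hr|Hr].
    { right. apply edge_config_single; auto; [lia|].
      assert (m = k + 1 \/ m = k + 2)%nat as [->| ->] by lia; split; try (apply slot_strict; lia).
      - replace (k + 1 + 1)%nat with (k + 2)%nat by lia. auto.
      - replace (k + 2 - 1)%nat with (k + 1)%nat by lia. auto. }
    assert (Hmm : slot m = slot (k + 1)) by (assert (m = k + 1 \/ m = k + 2)%nat as [->| ->] by lia; auto).
    rewrite Hmm in *. left.
    pose proof (slot_step_eq k ltac:(lia)) as E1. replace (S k) with (k + 1)%nat in E1 by lia.
    pose proof (slot_strict (k + 1) (k + 3) ltac:(lia) ltac:(lia)).
    assert (Hu : forall j, (j <= k + 3)%nat -> slot j = slot (k + 1) -> (j = k + 1 \/ j = k + 2)%nat).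
    { intros j Hj E. destruct (le_lt_dec j k) as [H'|H'].
      - pose proof (slot_mono j k H' ltac:(lia)). lra.
      - assert (j <> k + 3)%nat by (intros ->; lra). lia. }
    split.
    + rewrite multiplicity_inner; auto.
      * unfold slot_count. replace (k + 4)%nat with (k + 2 + 2)%nat by lia.
        rewrite seq_app, filter_app, length_app. fold (slot_count (slot (k + 1)) (seq 0 (k + 2))).
        fold (slot_count (slot (k + 1)) (seq (0 + (k + 2)) 2)). fold (slot_count (slot (k + 1)) (seq 1 c)).
        rewrite (slot_count_one _ 0 (k + 2) (k + 1)), (slot_count_one _ (0 + (k + 2)) 2 (k + 2)),
          (slot_count_none _ (seq 1 c)); auto; try lia.
        -- intros j Hj E. apply in_seq in Hj. apply Hu in E; lia.
        -- intros j Hj E. apply Hu in E; lia.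
        -- intros j Hj E. apply Hu in E; lia.
      * intros _ E. symmetry in E. apply Hu in E; lia.
      * intros _ E. symmetry in E. apply Hu in E; lia.
    + replace (2 * eta) with ((slot (k + 3) - slot k) / 2) by lra.
      apply owns_slot; auto; try lia; [lra|].
      intros h Hh. assert (h = k + 1 \/ h = k + 2)%nat as [->| ->] by lia; auto.
  - exact edge_config_deviation.
Qed.

End EdgeConfiguration.

(** * The number of players *)

Lemma Rsum_le (f g : nat -> R) l : (forall e, In e l -> f e <= g e) -> Rsum f l <= Rsum g l.
Proof.
  unfold Rsum; induction l as [|e l IH]; intros H; simpl; [lra|].
  pose proof (H e (or_introl eq_refl)).
  assert (fold_right Rplus 0 (map f l) <= fold_right Rplus 0 (map g l))
    by (apply IH; intros; apply H; now right).
  lra.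
Qed.

Lemma Rsum_linear (f g : nat -> R) a b l :
  Rsum (fun e => a * f e + b * g e) l = a * Rsum f l + b * Rsum g l.
Proof. unfold Rsum; induction l as [|e l IH]; simpl; [ring|rewrite IH; ring]. Qed.

Lemma Rsum_const a l : Rsum (fun _ => a) l = a * INR (length l).
Proof.
  unfold Rsum; induction l as [|e l IH]; [simpl; ring|].
  simpl length. rewrite S_INR. simpl. rewrite IH. ring.
Qed.

Lemma Rsum_INR (f : nat -> nat) l : Rsum (fun e => INR (f e)) l = INR (list_sum (map f l)).
Proof. unfold Rsum; induction l as [|e l IH]; simpl; [easy|]. rewrite IH, plus_INR. easy. Qed.

Lemma distribute (k : nat -> nat) l T : NoDup l -> (T <= list_sum (map k l))%nat ->
  exists c, (forall e, (c e <= k e)%nat) /\ list_sum (map c l) = T.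
Proof.
  intros Hl; revert T; induction Hl as [|e l He Hl IH]; intros T HT; simpl in *.
  - exists (fun _ => 0%nat). split; [lia|]. lia.
  - destruct (IH (T - min T (k e))%nat) as (c & Hc & Hs); [lia|].
    exists (fun f => if Nat.eqb f e then min T (k e) else c f). split.
    + intros f. destruct (Nat.eqb_spec f e) as [->|]; auto. lia.
    + rewrite Nat.eqb_refl.
      rewrite (map_ext_in _ c); [lia|].
      intros f Hf. destruct (Nat.eqb_spec f e) as [->|]; easy.
Qed.

Lemma Rceil_ge r : r <= IZR (Rceil r).
Proof. unfold Rceil. rewrite opp_IZR. destruct (base_Int_part (- r)). lra. Qed.

Definition nat_floor (r : R) : nat := Z.to_nat (Int_part r).

Lemma nat_floor_spec r : 0 <= r -> INR (nat_floor r) <= r < INR (nat_floor r) + 1.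
Proof.
  intros Hr. destruct (base_Int_part r) as [H1 H2].
  assert (0 <= Int_part r)%Z.
  { assert (-1 < Int_part r)%Z; [|lia]. apply lt_IZR. lra. }
  unfold nat_floor. rewrite INR_IZR_INZ, Z2Nat.id by auto. lra.
Qed.

Lemma nbar_ge N : 3 * INR (nE N) + 5 / minlen N * Rsum (len N) (seq 0 (nE N)) <= IZR (nbar N).
Proof.
  unfold nbar. rewrite plus_IZR, mult_IZR, <- INR_IZR_INZ.
  assert (H : forall l, 5 / minlen N * Rsum (len N) l <=
    IZR (fold_right Z.add 0%Z (map (fun e => Rceil (5 * len N e / minlen N)) l))).
  { unfold Rsum; induction l as [|e l IH]; simpl; [lra|]. rewrite plus_IZR.
    pose proof (Rceil_ge (5 * len N e / minlen N)) as Hc. unfold Rdiv in *. lra. }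
  specialize (H (seq 0 (nE N))). lra.
Qed.

Definition leaf_ends (N : network) (e : nat) : nat :=
  (if leafb N (src N e) then 1 else 0) + (if leafb N (dst N e) then 1 else 0).

Lemma leaf_ends_le N e : (leaf_ends N e <= 2)%nat.
Proof. unfold leaf_ends. destruct (leafb N (src N e)), (leafb N (dst N e)); lia. Qed.

Lemma edge_config_length N e eta k c :
  length (edge_config N e eta k c) = (k + c + (4 + leaf_ends N e))%nat.
Proof.
  unfold edge_config, slot_indices, leaf_ends. rewrite length_map, !length_app, !length_seq.
  destruct (leafb N (src N e)), (leafb N (dst N e)); simpl; lia.
Qed.

Lemma setback_sum N e eta :
  setback N eta (src N e) + setback N eta (dst N e) = INR (leaf_ends N e) * eta.
Proof.
  unfold setback, leaf_ends. destruct (leafb N (src N e)), (leafb N (dst N e)); simpl; ring.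
Qed.

Lemma edge_config_floor_balanced N e eta c : 0 < eta -> (4 + INR (leaf_ends N e)) * eta <= len N e ->
  let k := nat_floor ((len N e / eta - 4 - INR (leaf_ends N e)) / 2) in
  (c <= k)%nat -> edge_balanced N eta (edge_config N e eta k c) e.
Proof.
  intros Heta Hlen k Hc.
  assert (Hr : 0 <= (len N e / eta - 4 - INR (leaf_ends N e)) / 2).
  { assert (4 + INR (leaf_ends N e) <= len N e / eta); [|lra].
    apply Rmult_le_reg_r with eta; auto. unfold Rdiv. rewrite Rmult_assoc, Rinv_l; lra. }
  pose proof (nat_floor_spec _ Hr) as [H1 H2]. fold k in H1, H2.
  apply (Rmult_le_compat_l (2 * eta)) in H1; [|lra].
  apply (Rmult_lt_compat_l (2 * eta)) in H2; [|lra].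
  replace (2 * eta * ((len N e / eta - 4 - INR (leaf_ends N e)) / 2))
    with (len N e - 4 * eta - INR (leaf_ends N e) * eta) in H1, H2 by (field; lra).
  pose proof (setback_sum N e eta).
  assert (E1 : slot N e eta k (k + 1) = setback N eta (src N e) + 2 * eta * (INR k + 1)).
  { unfold slot. rewrite Nat.leb_refl, plus_INR. reflexivity. }
  assert (E2 : slot N e eta k (k + 2) = len N e - setback N eta (dst N e) - 2 * eta).
  { unfold slot. rewrite (proj2 (Nat.leb_gt _ _)), Nat.eqb_refl by lia. reflexivity. }
  apply edge_config_balanced; auto; rewrite E1, E2; lra.
Qed.

Theorem mainTheorem1 (N : network) (HN : is_network N) (n : nat)
  (hn : (nbar N <= Z.of_nat n)%Z) : has_pure_NE N n.
Proof.
  set (S0 := seq 0 (nE N)).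
  set (X := Rsum (len N) S0). set (E := INR (nE N)).
  set (l := Rsum (fun e => INR (leaf_ends N e)) S0).
  assert (HS : forall e, In e S0 -> (e < nE N)%nat) by (intros e He; apply in_seq in He; lia).
  assert (HE : 1 <= E) by (apply (le_INR 1), HN).
  assert (HES : INR (length S0) = E) by (unfold S0; now rewrite length_seq).
  pose proof (minlen_pos N HN) as Hm. set (m := minlen N) in *.
  assert (HX : m * E <= X).
  { rewrite <- HES, <- Rsum_const. apply Rsum_le. intros e He. apply minlen_le; auto. }
  assert (Hl : l <= 2 * E).
  { rewrite <- HES, <- Rsum_const. apply Rsum_le. intros e He.
    apply (le_INR _ 2), leaf_ends_le. }
  assert (Hl0 : 0 <= l).
  { replace 0 with (0 * INR (length S0)) by ring. rewrite <- Rsum_const. apply Rsum_le.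
    intros; apply pos_INR. }
  assert (Hn : 3 * E + 5 / m * X <= INR n).
  { eapply Rle_trans; [apply nbar_ge|]. rewrite INR_IZR_INZ. now apply IZR_le. }
  assert (HXm : E <= X / m).
  { apply Rmult_le_reg_r with m; auto. unfold Rdiv. rewrite Rmult_assoc, Rinv_l; lra. }
  replace (5 / m * X) with (5 * (X / m)) in Hn by (field; lra).
  set (D := 2 * INR n - 4 * E - l).
  assert (HD : 10 * (X / m) <= D) by (unfold D; lra).
  assert (HX0 : 0 < X) by nra.
  assert (HD0 : 0 < D) by lra.
  set (eta := X / D).
  assert (Heta : 0 < eta) by (apply Rdiv_lt_0_compat; auto).
  assert (Hetam : 10 * eta <= m).
  { unfold eta. apply Rmult_le_reg_r with (D / m); [apply Rdiv_lt_0_compat; auto|].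
    replace (10 * (X / D) * (D / m)) with (10 * (X / m)) by (field; lra).
    replace (m * (D / m)) with D by (field; lra). lra. }
  set (k := fun e => nat_floor ((len N e / eta - 4 - INR (leaf_ends N e)) / 2)).
  assert (Hroom : forall e, (e < nE N)%nat -> (4 + INR (leaf_ends N e)) * eta <= len N e).
  { intros e He. pose proof (minlen_le N e He). pose proof (le_INR _ _ (leaf_ends_le N e)) as H2.
    simpl in H2. fold m in H. nra. }
  assert (Hk : forall e, (e < nE N)%nat ->
    2 * INR (k e) <= len N e / eta - 4 - INR (leaf_ends N e) <= 2 * INR (k e) + 2).
  { intros e He. specialize (Hroom e He).
    assert (4 + INR (leaf_ends N e) <= len N e / eta).
    { apply Rmult_le_reg_r with eta; auto. unfold Rdiv. rewrite Rmult_assoc, Rinv_l; lra. }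
    pose proof (nat_floor_spec ((len N e / eta - 4 - INR (leaf_ends N e)) / 2) ltac:(lra)) as H1.
    fold (k e) in H1. lra. }
  set (K := list_sum (map k S0)).
  assert (Hsum : Rsum (fun e => len N e / eta - 4 - INR (leaf_ends N e)) S0 = D - 4 * E - l).
  { transitivity (Rsum (fun e => / eta * len N e +
      1 * ((-1) * INR (leaf_ends N e) + (-4) * 1)) S0).
    - unfold Rsum. f_equal. apply map_ext. intros e. field. lra.
    - rewrite Rsum_linear, (Rsum_linear (fun e => INR (leaf_ends N e)) (fun _ => 1)), Rsum_const, HES.
      fold l X. unfold eta. field. lra. }
  assert (HK1 : 2 * INR K <= D - 4 * E - l).
  { rewrite <- Hsum. unfold K. rewrite <- Rsum_INR.
    transitivity (Rsum (fun e => 2 * INR (k e) + 0 * 1) S0).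
    - rewrite (Rsum_linear (fun e => INR (k e)) (fun _ => 1)). lra.
    - apply Rsum_le. intros e He. pose proof (Hk e (HS e He)). lra. }
  assert (HK2 : D - 4 * E - l <= 2 * INR K + 2 * E).
  { rewrite <- Hsum. unfold K. rewrite <- Rsum_INR.
    transitivity (Rsum (fun e => 2 * INR (k e) + 2 * 1) S0).
    - apply Rsum_le. intros e He. pose proof (Hk e (HS e He)). lra.
    - rewrite (Rsum_linear (fun e => INR (k e)) (fun _ => 1)), Rsum_const, HES. lra. }
  set (C := list_sum (map (fun e => (4 + leaf_ends N e)%nat) S0)).
  assert (HC : INR C = 4 * E + l).
  { unfold C. rewrite <- Rsum_INR. transitivity (Rsum (fun e => 4 * 1 + 1 * INR (leaf_ends N e)) S0).
    - unfold Rsum. f_equal. apply map_ext. intros e. rewrite plus_INR. simpl. ring.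
    - rewrite (Rsum_linear (fun _ => 1)), Rsum_const, HES. fold l. ring. }
  assert (HCK : (C + K <= n)%nat).
  { apply INR_le. rewrite plus_INR, HC. unfold D in HK1. lra. }
  assert (HCK2 : (n - (C + K) <= K)%nat).
  { apply INR_le. rewrite minus_INR, plus_INR, HC by auto. unfold D in HK2. lra. }
  destruct (distribute k S0 (n - (C + K)) (seq_NoDup _ _) HCK2) as (c & Hc & Hcs).
  set (L := fun e => edge_config N e eta (k e) (c e)).
  assert (Hlen : length (config_points N L) = n).
  { unfold config_points. rewrite length_flat_map.
    rewrite (map_ext _ (fun e => (k e + (c e + (4 + leaf_ends N e)))%nat)).
    - assert (Hadd : forall (f g : nat -> nat) s, list_sum (map (fun e => (f e + g e)%nat) s) =
        (list_sum (map f s) + list_sum (map g s))%nat)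
        by (intros f g; induction s as [|a s IH]; simpl; [easy|]; rewrite IH; lia).
      fold S0. rewrite Hadd, Hadd. fold K C. lia.
    - intros e. rewrite length_map. unfold L. rewrite edge_config_length. lia. }
  rewrite <- Hlen. apply balanced_equilibrium with eta; auto.
  - intros e He. apply edge_config_floor_balanced; auto.
  - intros v e He Hinc Hleaf.
    assert (Hne : degree N v <> 1%nat) by (apply Nat.eqb_neq; exact Hleaf).
    assert (degree N v <> 0%nat); [|lia]. intros H0.
    unfold degree in H0. apply length_zero_iff_nil in H0.
    assert (Hin : In e nil); [|easy]. rewrite <- H0. apply filter_In. split; [apply in_seq; lia|].
    exact Hinc.
Qed.
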